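(* Let $\mathcal{H}$ be a real Hilbert space, $f:\mathcal{H}\to\mathbb{R}$ a convex function with $\operatorname{argmin} f\neq\emptyset$, $\tilde f:\mathcal{H}\times[0,\infty)\to\mathbb{R}$ a smoothing function of $f$ (in the sense of the context), $\alpha>0$, $t_0>0$, and let $\mu:[0,\infty)\to[0,\infty)$ be continuously differentiable and strictly decreasing with $\lim_{t\to\infty}\mu(t)=0$ and $\int_{t_0}^\infty t\mu(t)\,dt<\infty$. Let $g:[t_0,\infty)\to\mathcal{H}$ be (strongly) measurable with $\int_{t_0}^\infty t\|g(t)\|\,dt<\infty$, and let $x:[t_0,\infty)\to\mathcal{H}$ be a trajectory of $$\ddot x(t)+\frac{\alpha}{t}\dot x(t)+\nabla_x\tilde f(x(t),\mu(t))=g(t).$$ (i) If $\alpha\ge 3$, then $f(x(t))-\min f=O\left(\frac{1}{t^2}\right)$ as $t\to\infty$. (ii) If $\alpha>3$, then $x$ is bounded on $[t_0,\infty)$, $$\int_{t_0}^\infty t\,\bigl(f(x(t))-\min f\bigr)\,dt<\infty,\qquad \int_{t_0}^\infty t\,\|\dot x(t)\|^2\,dt<\infty,$$ and $f(x(t))-\min f=o\left(\frac{1}{t^2}\right)$ as $t\to\infty$.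
   Context: A function $\tilde f:\mathcal{H}\times[0,\infty)\to\mathbb{R}$ is called a smoothing function of the convex function $f:\mathcal{H}\to\mathbb{R}$ if: (i) for each fixed $\mu>0$, $\tilde f(\cdot,\mu)$ is continuously differentiable on $\mathcal{H}$, and for each fixed $x\in\mathcal{H}$, $\tilde f(x,\cdot)$ is continuously differentiable on $(0,\infty)$; (ii) $\lim_{z\to x,\ \mu\downarrow 0}\tilde f(z,\mu)=f(x)$ for all $x\in\mathcal{H}$; (iii) $\tilde f(\cdot,\mu)$ is convex on $\mathcal{H}$ for each fixed $\mu>0$; (iv) there is a constant $\kappa>0$ with $|\nabla_\mu\tilde f(x,\mu)|\le\kappa$ for all $\mu\in(0,\infty)$, $x\in\mathcal{H}$; (v) there is a constant $L>0$ such that for every $\mu\in(0,\infty)$, $\nabla_x\tilde f(\cdot,\mu)$ is Lipschitz continuous on $\mathcal{H}$ with constant $L\mu^{-1}$; (vi) for each fixed $z\in\mathcal{H}$, $\mu\mapsto\nabla_z\tilde f(z,\mu)$ is continuous on $(0,\infty)$. Here $\nabla_x\tilde f$ and $\nabla_\mu\tilde f$ denote the gradient in the first variable and the derivative in the second variable. A trajectory is a continuously differentiable function $x:[t_0,\infty)\to\mathcal{H}$ whose derivative $\dot x$ is locally absolutely continuous and which satisfies the differential equation for almost every $t\ge t_0$. Since $\mu$ is strictly decreasing with limit $0$, one has $\mu(t)>0$ for all $t\geq 0$. *)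

(* Defs.v *)
From HB Require Import structures.
From mathcomp Require Import all_boot all_order all_algebra sesquilinear.
From mathcomp Require Import all_classical all_reals all_analysis.

Set Implicit Arguments.
Unset Strict Implicit.
Unset Printing Implicit Defensive.

Import Order.TTheory GRing.Theory Num.Theory.
Import numFieldNormedType.Exports.

Local Open Scope classical_set_scope.
Local Open Scope ring_scope.

Definition argmin (R : realType) (T : Type) (f : T -> R) : set T :=
  [set z | forall y, f z <= f y].

(* Lets [pinfty_nbhs R] index the Landau notations. *)
Canonical pinfty_filter_on (R : numFieldType) : filter_on R :=
  FilterType (pinfty_nbhs R) _.

(* Derivatives along a domain [A], one-sided at its boundary points. The values
   of [f] outside [A] play no role at points of [A]. *)
Definition derivable_on (R : realType) (V : normedModType R) (A : set R)
    (f : R -> V) (t : R) : Prop :=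
  cvg (h^-1 *: (f (h + t) - f t) @[h --> within [set h | A (h + t)] 0^']).

Definition derive_on (R : realType) (V : normedModType R) (A : set R)
    (f : R -> V) (t : R) : V :=
  lim (h^-1 *: (f (h + t) - f t) @[h --> within [set h | A (h + t)] 0^']).

Definition C1_on (R : realType) (V : normedModType R) (A : set R)
    (f : R -> V) : Prop :=
  (forall t, A t -> derivable_on A f t) /\
  {within A, continuous (derive_on A f)}.

Definition abs_continuous (R : realType) (V : normedModType R) (a b : R)
    (f : R -> V) : Prop :=
  forall e : R, 0 < e -> exists2 d : R, 0 < d &
    forall (n : nat) (u v : 'I_n -> R),
      (forall i, a <= u i <= v i /\ v i <= b) ->
      trivIset setT (fun i => `]u i, v i[%classic) ->
      \sum_i (v i - u i) < d -> \sum_i `|f (v i) - f (u i)| < e.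

Definition loc_abs_continuous (R : realType) (V : normedModType R) (A : set R)
    (f : R -> V) : Prop :=
  forall a b : R, `[a, b] `<=` A -> abs_continuous a b f.

(* Bochner measurability with respect to Lebesgue measure: almost everywhere
   limit of simple functions. *)
Definition strongly_measurable (R : realType) (V : normedModType R) (A : set R)
    (g : R -> V) : Prop :=
  exists s : nat -> R -> V,
    (forall n, finite_set (s n @` A) /\
       forall y, measurable (A `&` s n @^-1` [set y])) /\
    {ae lebesgue_measure, forall t, A t -> s n t @[n --> \oo] --> g t}.

(* [dot] is meant to satisfy [dot u u = `|u| ^+ 2]; by completeness of [H] the
   representative then exists and is unique wherever [f] is differentiable. *)
Definition gradient (R : realType) (H : completeNormedModType R)
    (dot : {dot H for idfun}) (f : H -> R^o) (x : H) : H :=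
  get (fun v => forall h, 'd f x h = dot v h).

(* The conditions on [ft : H * [0, +oo[ -> R] only involve the values
   [ft z m] with [0 < m]. *)
Record smoothing_function (R : realType) (H : completeNormedModType R)
    (dot : {dot H for idfun}) (f : H -> R) (ft : H -> R -> R) : Prop := {
  smoothing_C1_space : forall m : R, 0 < m ->
    (forall z, differentiable (ft^~ m : H -> R^o) z) /\
    continuous (gradient dot (ft^~ m)) ;
  smoothing_C1_param : forall (z : H) (m : R), 0 < m ->
    derivable (ft z : R -> R^o) m 1 /\
    {for m, continuous (derive1 (ft z : R -> R^o))} ;
  smoothing_limit : forall x,
    ft p.1 p.2 @[p --> filter_prod (nbhs x) (at_right 0)] --> f x ;
  smoothing_convex : forall m : R, 0 < m -> convex_function setT (ft^~ m) ;
  smoothing_param_bound : exists2 kappa : R, 0 < kappa &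
    forall (z : H) (m : R), 0 < m -> `|derive1 (ft z : R -> R^o) m| <= kappa ;
  smoothing_lipschitz : exists2 L : R, 0 < L &
    forall m : R, 0 < m -> (L * m^-1).-lipschitz (gradient dot (ft^~ m)) ;
  smoothing_gradient_continuous : forall (z : H) (m : R), 0 < m ->
    {for m, continuous (fun m' => gradient dot (ft^~ m') z)} }.

Record trajectory (R : realType) (H : completeNormedModType R)
    (dot : {dot H for idfun}) (ft : H -> R -> R) (mu : R -> R) (g : R -> H)
    (alpha t0 : R) (x : R -> H) : Prop := {
  trajectory_C1 : C1_on `[t0, +oo[ x ;
  trajectory_loc_ac : loc_abs_continuous `[t0, +oo[ (derive_on `[t0, +oo[ x) ;
  trajectory_ode : {ae lebesgue_measure, forall t, t0 <= t ->
    derivable_on `[t0, +oo[ (derive_on `[t0, +oo[ x) t /\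
    derive_on `[t0, +oo[ (derive_on `[t0, +oo[ x) t
      + (alpha / t) *: derive_on `[t0, +oo[ x t
      + gradient dot (ft^~ (mu t)) (x t) = g t} }.

(* Main.v *)
Require Import Defs.
From HB Require Import structures.
From mathcomp Require Import all_boot all_order all_algebra sesquilinear.
From mathcomp Require Import all_classical all_reals all_analysis.
From mathcomp Require Import measurable_realfun ring lra.

(* Let z be a minimiser of f, W(t) = ft(x(t), mu(t)) + kappa mu(t) - f(z) and
   v(t) = (alpha - 1)(x(t) - z) + t x'(t).  The energy 2 t^2 W + |v|^2 has
   derivative at most
     - 2 (alpha - 3) t W + 2 t |v| |g| + 4 kappa (alpha - 1) t mu,
   so that v is bounded, hence t^2 W is bounded and, if alpha > 3, t W is
   integrable.  Since f(x(t)) - f(z) <= W(t), this gives (i) and part of (ii).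
   The derivatives of |t (x - z)|^2 and of Z = 2 t^2 W + |t x'|^2 are then
   controlled by the bound on v, which yields the boundedness of x and the
   integrability of t |x'|^2; finally Z / t is integrable and Z increases by
   arbitrarily little at infinity, so that Z tends to 0.

   Because m |-> ft z m + kappa m is nondecreasing and mu is decreasing,
   convexity gives W(s) - W(t) <= <grad ft(x(s), mu(s)), x(s) - x(t)> for
   t <= s: W need not be differentiated, one-sided upper bounds on increments
   suffice.  The energy inequalities hold almost everywhere and are integrated
   using the absolute continuity of x'. *)

Set Implicit Arguments.
Unset Strict Implicit.
Unset Printing Implicit Defensive.

Import Order.TTheory GRing.Theory Num.Theory.
Import numFieldNormedType.Exports.

Local Open Scope classical_set_scope.
Local Open Scope ring_scope.

(** * Inner product geometry and the Riesz representation *)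

Section Hilbert.
Context (R : realType) (H : completeNormedModType R) (dot : {dot H for idfun}).
Hypothesis dot_norm : forall u : H, dot u u = `|u| ^+ 2.
Implicit Types (u v w : H) (a : R).

Lemma dotC u v : dot u v = dot v u.
Proof. by rewrite hermC expr0 mul1r. Qed.

Lemma dotDl u v w : dot (u + v) w = dot u w + dot v w.
Proof. by rewrite linearDl. Qed.

Lemma dotDr u v w : dot w (u + v) = dot w u + dot w v.
Proof. by rewrite linearD. Qed.

Lemma dotZl a u w : dot (a *: u) w = a * dot u w.
Proof. by rewrite linearZl. Qed.

Lemma dotZr a u w : dot w (a *: u) = a * dot w u.
Proof. by rewrite linearZ. Qed.

Lemma dotNl u w : dot (- u) w = - dot u w.
Proof. by rewrite linearNl. Qed.

Lemma dotNr u w : dot w (- u) = - dot w u.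
Proof. by rewrite linearN. Qed.

Definition dotE := (dotDl, dotDr, dotNl, dotNr, dotZl, dotZr).

Lemma sqr_normD u v : `|u + v| ^+ 2 = `|u| ^+ 2 + 2 * dot u v + `|v| ^+ 2.
Proof. by rewrite -!dot_norm !dotE (dotC v u); ring. Qed.

Lemma sqr_normB u v : `|u - v| ^+ 2 = `|u| ^+ 2 - 2 * dot u v + `|v| ^+ 2.
Proof. by rewrite sqr_normD normrN dotNr mulrN. Qed.

(** Cauchy-Schwarz: with p and q the norms of [u] and [v], the squared norm of q u - p v equals 2 p
    q (p q - [dot u v]), which is nonnegative. *)
Lemma ler_dot u v : dot u v <= `|u| * `|v|.
Proof.
have [->|v0] := eqVneq v 0.
  by rewrite -(scale0r (0 : H)) dotZr mul0r scale0r normr0 mulr0.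
have [->|u0] := eqVneq u 0.
  by rewrite -(scale0r (0 : H)) dotZl mul0r scale0r normr0 mul0r.
have : 0 <= `|(`|v| *: u - `|u| *: v)| ^+ 2 by rewrite sqr_ge0.
rewrite sqr_normB !normrZ !normr_id !exprMn dotZl dotZr.
have : 0 < `|u| * `|v| by rewrite mulr_gt0 ?normr_gt0.
set p := `|u|; set q := `|v|; set d := dot u v => pq.
have -> : q ^+ 2 * p ^+ 2 - 2 * (q * (p * d)) + p ^+ 2 * q ^+ 2
   = 2 * (p * q) * (p * q - d) by ring.
by rewrite pmulr_rge0 ?subr_ge0 // mulr_gt0.
Qed.

Lemma cvg_sqr_norm {T : Type} (F : set_system T) {FF : Filter F} (p : T -> H) u :
  p @ F --> u -> `|p t| ^+ 2 @[t --> F] --> `|u| ^+ 2.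
Proof. by move=> pu; exact: (cvgM (cvg_norm pu) (cvg_norm pu)). Qed.

(** By polarisation, continuity of the inner product reduces to that of the norm. *)
Lemma cvg_dot {T : Type} (F : set_system T) {FF : Filter F} (p q : T -> H) u v :
  p @ F --> u -> q @ F --> v -> dot (p t) (q t) @[t --> F] --> dot u v.
Proof.
move=> pu qv.
have pq (a b : H) : dot a b = (`|a + b| ^+ 2 - `|a - b| ^+ 2) / 4.
  by rewrite sqr_normD sqr_normB; field.
have -> : (fun t => dot (p t) (q t)) =
    (fun t => (`|p t + q t| ^+ 2 - `|p t - q t| ^+ 2) / 4) by apply/funext => t.
rewrite pq; apply: cvgM; last exact: cvg_cst.
apply: cvgB; apply: cvg_sqr_norm; [exact: cvgD|exact: cvgB].
Qed.

(* The representative minimises [`|v| ^+ 2 - 2 * l v]; minimising sequences are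
   Cauchy by the parallelogram identity. *)
Lemma riesz_representation (l : {linear H -> R^o}) : continuous l ->
  exists v, forall h, l h = dot v h.
Proof.
move=> cl.
have [C [C0 lC]] : exists C, 0 <= C /\ forall h, l h <= C * `|h|.
  have /linear_boundedP lb := (linear_bounded_continuous l).2 cl.
  near (+oo : set_system R) => C; exists C; split.
    by near: C; exact: nbhs_pinfty_ge.
  move=> h; apply: le_trans (ler_norm _) _.
  by move: h; near: C.
pose J (v : H) : R := `|v| ^+ 2 - 2 * l v.
have Jlb v : - C ^+ 2 <= J v.
  rewrite /J; have := lC v; have := sqr_ge0 (`|v| - C).
  by rewrite sqrrB -mulr_natl; lra.
have hi : has_inf (range J).
  by split; [exists (J 0), 0|exists (- C ^+ 2) => _ [v _ <-]; exact: Jlb].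
pose m := inf (range J).
have mJ v : m <= J v by apply: ge_inf; [case: hi|exists v].
have /choice[u uP] : forall n : nat, exists v, J v < m + n.+1%:R^-1.
  move=> n; have e0 : (0 : R) < n.+1%:R^-1 by rewrite invr_gt0.
  by have [_ [v _ <-] ?] := inf_adherent e0 hi; exists v.
have par v w : `|v - w| ^+ 2 <= 2 * (J v - m) + 2 * (J w - m).
  have := mJ (2^-1 *: (v + w)); rewrite /J normrZ exprMn.
  have -> : l (2^-1 *: (v + w)) = 2^-1 * (l v + l w) by rewrite linearZ linearD.
  rewrite sqr_normB sqr_normD ger0_norm ?invr_ge0//.
  by lra.
have cu : cvg (u @ \oo).
  apply/cauchy_cvgP/cauchy_exP => e e0.
  (* Beyond [N], [J (u n)] and [J (u N)] are both below [m + N.+1%:R^-1], so [par] bounds the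
     squared distance by four times [N.+1%:R^-1], hence by [e ^+ 2]. *)
  have [N _ /(_ _ (leqnn _)) Ne] := @near_infty_natSinv_lt R
    (PosNum (divr_gt0 (exprn_gt0 2 e0) (ltr0n _ 4))).
  exists (u N), N => // n /= Nn; rewrite -ball_normE/=.
  rewrite -(@ltr_pXn2r _ 2) ?nnegrE// ?ltW//; apply: le_lt_trans (par _ _) _.
  have nN : n.+1%:R^-1 <= N.+1%:R^-1 :> R by rewrite lef_pV2 ?posrE// ler_nat.
  move: Ne (uP n) (uP N) => /=; rewrite ltr_pdivlMr//.
  move: nN; set a := n.+1%:R^-1; set b := N.+1%:R^-1; move: (J (u n)) (J (u N)) => p q.
  by move: a b => a b; lra.
have Ju : J (lim (u @ \oo)) <= m.
  have Jc : J (u n) @[n --> \oo] --> J (lim (u @ \oo)).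
    apply: cvgB; first exact: cvg_sqr_norm.
    by apply: cvgM; [exact: cvg_cst|apply: (@cvg_comp _ _ _ u l _ _ _ cu); exact: cl].
  have mc : m + n.+1%:R^-1 @[n --> \oo] --> m.
    by rewrite -[X in _ --> X]addr0; apply: cvgD; [exact: cvg_cst|exact: cvg_harmonic].
  by apply: (ler_cvg_to Jc mc); apply: nearW => n; exact/ltW/uP.
exists (lim (u @ \oo)) => h; set v := lim _ in Ju *.
have key s : 0 <= s * 2 * (dot v h - l h) + s ^+ 2 * `|h| ^+ 2.
  have := le_trans Ju (mJ (v + s *: h)).
  rewrite /J sqr_normD dotZr normrZ exprMn real_normK ?num_real//.
  have -> : l (v + s *: h) = l v + s * l h by rewrite linearD linearZ.
  by lra.
set d := dot v h - l h in key.
apply/eqP; rewrite eq_sym -subr_eq0 -/d; apply/eqP.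
have [h0|h0] := eqVneq h 0.
  by rewrite /d h0 (linear0 l) -(scale0r (0 : H)) dotZr mul0r subrr.
have hp : 0 < `|h| ^+ 2 by rewrite exprn_gt0// normr_gt0.
(* This value of [s] minimises the quadratic polynomial in [key]; nonnegativity of its minimum
   [- (d ^+ 2 / q)] forces [d = 0]. *)
have := key (- d / `|h| ^+ 2); set q := `|h| ^+ 2 in hp *.
have -> : - d / q * 2 * d + (- d / q) ^+ 2 * q = - (d ^+ 2 / q).
  by field; rewrite gt_eqF.
rewrite oppr_ge0 pmulr_lle0 ?invr_gt0// => d2.
by apply/eqP; rewrite -sqrf_eq0; apply/eqP/le_anti; rewrite d2 sqr_ge0.
Unshelve. all: by end_near. Qed.

End Hilbert.

(** * Gradients and properties of smoothing functions *)

Section Smoothing.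
Context (R : realType) (H : completeNormedModType R) (dot : {dot H for idfun}).
Hypothesis dot_norm : forall u : H, dot u u = `|u| ^+ 2.

(** The Riesz representation guarantees that the [get] in [gradient] does not fall back on its
    default value. *)
Lemma gradientP (F : H -> R^o) x : differentiable F x ->
  forall h, 'd F x h = dot (gradient dot F x) h.
Proof.
move=> dF; rewrite /gradient; case: xgetP => [v _ //|none].
have [v vP] := riesz_representation dot_norm (diff_continuous dF).
by have := none v vP.
Qed.

(** By convexity the difference quotients towards [y] with step in []0, 1]] are at most [F y - F x];
    the step then tends to 0 from the right. *)
Lemma convex_gradient_le (F : H -> R^o) x y : convex_function setT F ->
  differentiable F x -> F x + dot (gradient dot F x) (y - x) <= F y.
Proof.
move=> cF dF; rewrite -gradientP// -deriveE// addrC -lerBrDr.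
have dc : h^-1 *: ((F \o shift x) (h *: (y - x)) - F x) @[h --> (0 : R)^'+]
    --> 'D_(y - x) F x by apply: cvg_dnbhs_at_right; exact: diff_derivable.
apply: (ler_cvg_to dc (cvg_cst (F y - F x : R))).
near=> h.
have h0 : 0 < h by [].
have h1 : h <= 1 by near: h; exact: nbhs_right_le.
have := cF (Itv01 (ltW h0) h1) y x (in_setT _) (in_setT _).
have -> : conv (Itv01 (ltW h0) h1) (y : convex_lmodType H) x = h *: (y - x) + x.
  by rewrite /conv/= scalerBr scalerBl scale1r addrA addrAC.
rewrite convRE /= => cFh.
rewrite /GRing.scale/= ler_pdivrMl// lerBlDr; apply: le_trans cFh _.
suff -> : h * F y + (1 - h) * F x = h * (F y - F x) + F x by []. ring.
Unshelve. all: by end_near. Qed.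

Context (f : H -> R) (ft : H -> R -> R).
Hypothesis fts : smoothing_function dot f ft.

(** Mean value theorem in the parameter, with the constant of [smoothing_param_bound]. *)
Lemma smoothing_param_lipschitz : exists2 kappa : R, 0 < kappa &
  forall z (m m' : R), 0 < m' -> m' <= m -> `|ft z m - ft z m'| <= kappa * (m - m').
Proof.
have [k k0 kP] := smoothing_param_bound fts; exists k => // z m m' m'0 m'm.
have der (c : R) : 0 < c -> is_derive c 1 (ft z : R -> R^o) (derive1 (ft z : R -> R^o) c).
  by move=> c0; rewrite derive1E; apply: derivableP; have [] := smoothing_C1_param fts z c0.
have [c|| c] := @MVT_segment _ (ft z) (derive1 (ft z : R -> R^o)) _ _ m'm.
- by rewrite in_itv/= => /andP[m'c _]; apply: der; exact: lt_trans m'c.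
- apply: derivable_within_continuous => c; rewrite in_itv/= => /andP[m'c _].
  by have [] := smoothing_C1_param fts z (lt_le_trans m'0 m'c).
rewrite in_itv/= => /andP[m'c _] ->.
rewrite normrM (ger0_norm (_ : 0 <= m - m')) ?subr_ge0//.
by rewrite ler_wpM2r ?subr_ge0// kP// (lt_le_trans m'0).
Qed.

(** The Lipschitz bound in the parameter is passed to the limit [m' -> 0] at fixed [z], where
    [ft z m'] tends to [f z]. *)
Lemma smoothing_approx kappa :
  (forall z (m m' : R), 0 < m' -> m' <= m -> `|ft z m - ft z m'| <= kappa * (m - m')) ->
  forall z (m : R), 0 < m -> `|ft z m - f z| <= kappa * m.
Proof.
move=> kP z m m0.
have lz : ft z m' @[m' --> (0:R)^'+] --> f z.
  have zm : (z, m') @[m' --> (0:R)^'+] --> filter_prod (nbhs z) ((0:R)^'+).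
    move=> B [[P Q] [/= Pz Q0] PQ]; suff : \forall m' \near (0:R)^'+, B (z, m') by [].
    near=> m'; apply: (PQ (z, m')).
    by split => /=; [exact: nbhs_singleton|near: m'; exact: Q0].
  exact: (cvg_comp _ _ zm (@smoothing_limit _ _ _ _ _ fts z)).
have l1 : `|ft z m - ft z m'| @[m' --> (0:R)^'+] --> `|ft z m - f z|.
  by apply: (@cvg_norm _ R^o); apply: cvgB => //; exact: cvg_cst.
have l2 : kappa * (m - m') @[m' --> (0:R)^'+] --> kappa * (m - 0).
  apply: cvgM; first exact: cvg_cst.
  by apply: cvgB; [exact: cvg_cst|exact: cvg_at_right_filter].
rewrite -[m in leRHS]subr0; apply: (ler_cvg_to l1 l2).
near=> m'; apply: kP; first by [].
by near: m'; exact: nbhs_right_le.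
Unshelve. all: by end_near. Qed.

(** Separate continuity becomes joint continuity because the Lipschitz constants in the space
    variable are uniform for parameters away from 0. *)
Lemma cvg_smoothing_gradient {T : Type} (F : set_system T) {FF : Filter F}
    (X : T -> H) (M : T -> R) (z : H) (m : R) : 0 < m -> X @ F --> z -> M @ F --> m ->
  gradient dot (ft^~ (M t)) (X t) @[t --> F] --> gradient dot (ft^~ m) z.
Proof.
move=> m0 Xz Mm.
have [L L0 LP] := smoothing_lipschitz fts.
have c1 : gradient dot (ft^~ (M t)) z @[t --> F] --> gradient dot (ft^~ m) z.
  exact: (@cvg_comp _ _ _ M _ _ _ _ Mm (smoothing_gradient_continuous fts (z := z) m0)).
have c2 : gradient dot (ft^~ (M t)) (X t) - gradient dot (ft^~ (M t)) z @[t --> F] --> 0.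
  apply/cvgr0Pnorm_lt => e e0.
  have e' : 0 < e / (L * (m / 2)^-1) by rewrite divr_gt0// mulr_gt0// invr_gt0 divr_gt0.
  (* Once [M t] exceeds [m / 2], every gradient involved has Lipschitz constant at most
     [L * (m / 2)^-1]. *)
  have m2 : m / 2 < m by rewrite ltr_pdivrMr// ltr_pMr// ltr1n.
  move/cvgrPdist_lt : Xz => /(_ _ e') Xz.
  have Mnear := cvgr_gt m Mm _ m2.
  near=> t.
  have Mt : m / 2 < M t by near: t; exact: Mnear.
  have Mt0 : 0 < M t by apply: lt_trans Mt; rewrite divr_gt0.
  have /= := LP _ Mt0 (X t, z) (conj I I); rewrite /= => /le_lt_trans; apply.
  have : `|z - X t| < e / (L * (m / 2)^-1) by near: t; exact: Xz.
  rewrite ltr_pdivlMr ?mulr_gt0// ?invr_gt0 ?divr_gt0// distrC mulrC.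
  apply: le_lt_trans; apply: ler_wpM2r => //; apply: ler_wpM2l; first exact: ltW.
  by rewrite lef_pV2 ?posrE ?divr_gt0// ltW.
have E : (fun t => gradient dot (ft^~ (M t)) (X t)) = (fun t => gradient dot (ft^~ (M t)) (X t)
    - gradient dot (ft^~ (M t)) z + gradient dot (ft^~ (M t)) z).
  by apply/funext => t; rewrite subrK.
by rewrite E -[X in _ --> X]add0r; exact: cvgD.
Unshelve. all: by end_near. Qed.

(** The change of parameter is controlled uniformly in the space variable, so only continuity at the
    fixed parameter [m] remains. *)
Lemma cvg_smoothing {T : Type} (F : set_system T) {FF : Filter F}
    (X : T -> H) (M : T -> R) (z : H) (m : R) : 0 < m -> X @ F --> z -> M @ F --> m ->
  ft (X t) (M t) @[t --> F] --> ft z m.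
Proof.
move=> m0 Xz Mm.
have [k k0 kP] := smoothing_param_lipschitz.
have c1 : ft (X t) m @[t --> F] --> ft z m.
  apply: (@cvg_comp _ _ _ X (ft^~ m : H -> R^o) _ _ _ Xz).
  by apply: differentiable_continuous; have [+ _] := smoothing_C1_space fts m0; exact.
have c2 : ft (X t) (M t) - ft (X t) m @[t --> F] --> (0 : R).
  have d0 : k * `|M t - m| @[t --> F] --> (0 : R).
    rewrite -[in X in _ --> X](mulr0 k); apply: cvgM; first exact: cvg_cst.
    by apply/norm_cvg0P; rewrite -(subrr m); apply: cvgB => //; exact: cvg_cst.
  have Mt0 : \forall t \near F, 0 < M t by exact: (cvgr_gt m Mm _ m0).
  apply: (squeeze_cvgr _ (f := fun t => - (k * `|M t - m|)) _ d0); last first.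
    by rewrite -[X in _ --> X]oppr0; apply: cvgN.
  apply: filterS Mt0 => t Mt0; rewrite -ler_norml.
  have [mM|/ltW Mm'] := leP m (M t).
    by rewrite [X in k * X]ger0_norm ?subr_ge0// kP.
  by rewrite distrC (distrC (M t)) [X in k * X]ger0_norm ?subr_ge0// kP.
have E : (fun t => ft (X t) (M t)) = (fun t => ft (X t) (M t) - ft (X t) m + ft (X t) m).
  by apply/funext => t; rewrite subrK.
by rewrite E -[X in _ --> X]add0r; exact: cvgD.
Qed.

End Smoothing.

(** * Induction along an interval and bounds on Dini derivatives *)

(** Real induction: the supremum [c] of the points reachable from [a] is itself reachable by the
    left half of the local hypothesis, and the right half would pass beyond it if [c < b]. *)
Lemma interval_gauge_ind (R : realType) (P : R -> R -> Prop) (a b : R) :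
  a <= b ->
  (forall u v w, a <= u -> u <= v -> v <= w -> w <= b ->
     P u v -> P v w -> P u w) ->
  (forall t, a <= t <= b -> \forall s \near t,
     (a <= s -> s <= t -> P s t) /\ (t <= s -> s <= b -> P t s)) ->
  P a b.
Proof.
move=> ab Ptrans Ploc.
pose S := [set t | a <= t <= b /\ P a t].
have Sa : S a.
  split; first by rewrite lexx.
  have aab : a <= a <= b by rewrite lexx.
  by have [+ _] := nbhs_singleton (Ploc a aab); exact.
have hS : has_sup S by split; [exists a|exists b => t [/andP[]]].
have ca : a <= sup S by apply: sup_ubound => //; case: hS.
have cb : sup S <= b by apply: sup_le_ub; [exists a|move=> t [/andP[]]].
set c := sup S in ca cb.
have /nbhs_ballP[d /= d0 dP] : \forall s \near c,
    (a <= s -> s <= c -> P s c) /\ (c <= s -> s <= b -> P c s).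
  by apply: Ploc; rewrite ca.
have [s [/andP[sa sb] Pas] cs] := sup_adherent d0 hS.
have sc : s <= c by apply: sup_ubound; [case: hS|split => //; rewrite sa].
have Pac : P a c.
  apply: (Ptrans a s c) => //.
  apply: (dP s _).1 => //; rewrite /ball/= ger0_norm ?subr_ge0//.
  by rewrite ltrBlDr -ltrBlDl.
have [->//|cltb] := eqVneq b c.
have {}cltb : c < b by rewrite lt_neqAle eq_sym cltb.
(* A step to the right that stays both in the good neighbourhood of [c] and in the interval
   contradicts the choice of [c]. *)
have [e [e0 ed eb]] : exists e, [/\ 0 < e, e < d & c + e <= b].
  exists (Num.min (d / 2) (b - c)); split.
  - by rewrite lt_min divr_gt0//= subr_gt0.
  - by rewrite gt_min ltr_pdivrMr// ltr_pMr// ltr1n.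
  - by rewrite -lerBrDl ge_min lexx orbT.
have ce : c <= c + e by rewrite lerDl ltW.
have : S (c + e).
  split; first by rewrite eb (le_trans ca).
  apply: (Ptrans a c) => //; apply: (dP (c + e) _).2 => //.
  by rewrite /ball/= opprD addNKr normrN gtr0_norm.
move=> /(sup_ubound hS.2); rewrite -/c => /(lt_le_trans _) => /(_ c).
by rewrite ltrDl e0 ltxx; move/(_ isT).
Qed.

(* [l] bounds the upper Dini derivatives of [F] at [t] from both sides. *)
Definition upper_derivate (R : realType) (F : R -> R) (t l : R) :=
  forall e, 0 < e -> \forall s \near t,
    (s <= t -> F t - F s <= (l + e) * (t - s)) /\
    (t <= s -> F s - F t <= (l + e) * (s - t)).

Section UpperDerivate.
Context (R : realType).
Implicit Types (F G : R -> R) (t l m : R).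

Lemma upper_derivateD F G t l m : upper_derivate F t l ->
  upper_derivate G t m -> upper_derivate (fun s => F s + G s) t (l + m).
Proof.
move=> Fl Gm e e0; have e2 : 0 < e / 2 by rewrite divr_gt0.
near=> s.
have [F1 F2] : (s <= t -> F t - F s <= (l + e / 2) * (t - s)) /\
  (t <= s -> F s - F t <= (l + e / 2) * (s - t)) by near: s; exact: Fl.
have [G1 G2] : (s <= t -> G t - G s <= (m + e / 2) * (t - s)) /\
  (t <= s -> G s - G t <= (m + e / 2) * (s - t)) by near: s; exact: Gm.
split=> [st|ts]; [have := F1 st; have := G1 st|have := F2 ts; have := G2 ts]; lra.
Unshelve. all: by end_near. Qed.

Lemma le_upper_derivate F t l m : l <= m ->
  upper_derivate F t l -> upper_derivate F t m.
Proof.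
move=> lm Fl e e0; apply: filterS (Fl e e0) => s [F1 F2]; split=> ts.
  by apply: le_trans (F1 ts) _; rewrite ler_wpM2r ?subr_ge0// lerD2r.
by apply: le_trans (F2 ts) _; rewrite ler_wpM2r ?subr_ge0// lerD2r.
Qed.

(** A limit on the punctured neighbourhood suffices, since at [s = t] both inequalities to be proved
    read [0 <= 0]. *)
Lemma upper_derivate_quotient F (q : R -> R) t l :
  q @ t^' --> l ->
  (\forall s \near t, (s <= t -> F t - F s <= q s * (t - s)) /\
     (t <= s -> F s - F t <= q s * (s - t))) ->
  upper_derivate F t l.
Proof.
move=> ql Fq e e0.
have : \forall s \near t^', q s < l + e by apply: (cvgr_lt _ ql); rewrite ltrDl.
rewrite /dnbhs/within/= => qle.
near=> s.
have [F1 F2] : (s <= t -> F t - F s <= q s * (t - s)) /\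
     (t <= s -> F s - F t <= q s * (s - t)) by near: s.
have [->|st] := eqVneq s t; first by rewrite !subrr !mulr0.
have qs : q s < l + e by move: st; near: s.
split=> ts; [apply: le_trans (F1 ts) _|apply: le_trans (F2 ts) _];
  by rewrite ler_wpM2r ?subr_ge0// ltW.
Unshelve. all: by end_near. Qed.

End UpperDerivate.

(** * Monotonicity from almost everywhere derivative bounds *)

Section AbsoluteContinuity.
Context (R : realType) (V : normedModType R).
Local Notation mu := (@lebesgue_measure R).

Lemma sum_length_le n (p q : 'I_n -> R) (U : set R) : measurable U ->
  (forall i, p i <= q i) -> trivIset setT (fun i => `]p i, q i[%classic) ->
  (forall i, `]p i, q i[ `<=` U) ->
  ((\sum_i (q i - p i))%:E <= mu U)%E.
Proof.
move=> mU pq tr pU.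
have -> : (\sum_i (q i - p i))%:E = mu (\big[setU/set0]_i `]p i, q i[%classic).
  rewrite measure_bigsetU_ord// -sumEFin; apply: eq_bigr => i _.
  rewrite [RHS](lebesgue_measure_itv `]p i, q i[)/= lte_fin; have := pq i.
  by rewrite le_eqVlt => /predU1P[->|->]; rewrite ?ltxx ?subrr ?EFinB.
apply: le_measure; rewrite ?inE//; first exact: bigsetU_measurable.
by rewrite -bigcup_seq; apply: bigcup_sub => i _; exact: pU.
Qed.

(* The exceptional null set is covered by an open [U] of small measure.  The
   interval is cut into pieces which either lie in [U], where the increments of
   [Y] have a small sum, or touch a good point, where [F] increases at most
   with slope [e1]. *)
Lemma ac_nonincreasing (Y : R -> V) (F : R -> R) (a b C : R) :
  a <= b -> 0 <= C -> abs_continuous a b Y ->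
  (forall u v, a <= u -> u <= v -> v <= b ->
     F v - F u <= C * ((v - u) + `|Y v - Y u|)) ->
  {ae mu, forall t, a < t < b -> upper_derivate F t 0} ->
  F b <= F a.
Proof.
move=> ab C0 acY FC [N0 [mN0 N00 N0P]].
apply/ler_addgt0Pr => e e0.
(* The final estimate is [e1 * (b - a)] from the good pieces plus at most [C * (2 * e1)] from the
   pieces in [U]; the summand 1 keeps the denominator positive. *)
pose e1 := e / (b - a + 2 * C + 1).
have den0 : 0 < b - a + 2 * C + 1.
  by rewrite ltr_wpDl// addr_ge0 ?subr_ge0// mulr_ge0.
have e10 : 0 < e1 by rewrite divr_gt0.
have [d0 d00 acd] := acY _ e10.
pose d := Num.min d0 e1.
have d_gt0 : 0 < d by rewrite lt_min d00.
(* The endpoints are added because the derivative bound is only given inside the open interval. *)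
pose N : set R := N0 `|` [set a; b].
have mN : measurable N by apply: measurableU => //; apply: measurableU; exact: measurable_set1.
have muN : mu N = 0%E.
  apply/eqP; rewrite eq_le measure_ge0 andbT.
  apply: (le_trans (measureU2 _ _ _)) => //; first by apply: measurableU; exact: measurable_set1.
  apply: (le_trans (leeD2l _ (measureU2 _ _ _))); [exact: measurable_set1..|].
  by rewrite [X in (X + _)%E]N00 [X in (_ + (X + _))%E](lebesgue_measure_set1 a)
    [X in (_ + (_ + X))%E](lebesgue_measure_set1 b) !add0e.
have [U [oU NU muU]] : exists U, [/\ open U, N `<=` U & (mu (U `\` N) < d%:E)%E].
  by apply: lebesgue_regularity_outer => //; rewrite [X in (X < _)%E]muN ltry.
have mU : measurable U by exact: open_measurable.
have {}muU : (mu U < d%:E)%E.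
  apply: le_lt_trans muU; rewrite -{1}(setDUK NU) setUC.
  apply: (le_trans (measureU2 _ _ _)) => //; first exact: measurableD.
  by rewrite [X in (_ + X)%E]muN adde0.
(* The intervals []p i, q i[] are the pieces lying in [U]. Near a point of [U] a single piece is
   used, near any other point the empty family; families on adjacent intervals are concatenated. *)
pose P u v := exists n (p q : 'I_n -> R),
  [/\ forall i, u <= p i <= q i /\ q i <= v,
      trivIset setT (fun i => `]p i, q i[%classic),
      forall i, `]p i, q i[ `<=` U &
      F v - F u <= e1 * (v - u)
        + \sum_i C * ((q i - p i) + `|Y (q i) - Y (p i)|)].
have [||n [p [q [pq tr pU FP]]]] := @interval_gauge_ind R P a b ab.
- move=> u v w au uv vw wb [n1 [p1 [q1 [pq1 tr1 pU1 F1]]]]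
    [n2 [p2 [q2 [pq2 tr2 pU2 F2]]]].
  pose glue (h1 : 'I_n1 -> R) (h2 : 'I_n2 -> R) (i : 'I_(n1 + n2)) :=
    match fintype.split i with inl j => h1 j | inr j => h2 j end.
  have glueL h1 h2 i : glue h1 h2 (lshift n2 i) = h1 i.
    by rewrite /glue (unsplitK (inl i)).
  have glueR h1 h2 i : glue h1 h2 (rshift n1 i) = h2 i.
    by rewrite /glue (unsplitK (inr i)).
  exists (n1 + n2)%N, (glue p1 p2), (glue q1 q2); split.
  + move=> i; case: (split_ordP i) => j ->; rewrite ?glueL ?glueR.
      have [/andP[-> ->] /=] := pq1 j; move=> q1v; split => //.
      exact: le_trans vw.
    have [/andP[vp ->] ->] := pq2 j; split => //.
    by rewrite (le_trans uv vp).
  + have p1q2 z i j : z \in `]p1 i, q1 i[ -> z \in `]p2 j, q2 j[ -> False.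
      rewrite !in_itv/= => /andP[_ zq] /andP[pz _].
      have [_ q1v] := pq1 i; have [/andP[vp _] _] := pq2 j.
      by have := lt_trans (lt_le_trans zq q1v) (le_lt_trans vp pz); rewrite ltxx.
    move=> i j _ _; case: (split_ordP i) => i' ->; case: (split_ordP j) => j' ->;
      rewrite ?glueL ?glueR.
    * by move=> /tr1 ->.
    * by move=> [z [/= z1 z2]]; case: (p1q2 z i' j').
    * by move=> [z [/= z1 z2]]; case: (p1q2 z j' i').
    * by move=> /tr2 ->.
  + by move=> i; case: (split_ordP i) => j ->; rewrite ?glueL ?glueR; [exact: pU1|exact: pU2].
  + rewrite big_split_ord/=.
    under eq_bigr do rewrite !glueL.
    under [in X in _ + (_ + X)]eq_bigr do rewrite !glueR.
    by move: F1 F2; lra.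
- move=> t /andP[at_ tb]; have [Ut|nUt] := pselect (U t).
  + have /nbhs_ballP[r /= r0 rU] : nbhs t U by exact: open_nbhs_nbhs.
    have key s u : a <= s -> s <= u -> u <= b -> `]s, u[ `<=` U -> P s u.
      move=> as_ su ub sU; exists 1%N, (fun=> s), (fun=> u); split => //.
      * by move=> i; rewrite lexx su lexx.
      * by move=> i j _ _ _; rewrite !ord1.
      * rewrite big_ord1; apply: (le_trans (FC _ _ as_ su ub)).
        by rewrite lerDr mulr_ge0 ?subr_ge0// ltW.
    apply/nbhs_ballP; exists r => //= s; rewrite /ball/= => str.
    move: str; rewrite ltr_norml => /andP[s1 s2].
    split=> [as_ st|ts sb]; apply: key => // z /=; rewrite in_itv/= => /andP[z1 z2];
      apply: rU; rewrite /ball/= ltr_norml; apply/andP; split; lra.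
  + have Nt : ~ N t by move=> /NU.
    have tab : a < t < b.
      rewrite !lt_neqAle at_ tb !andbT; apply/andP; split; apply/eqP => E;
        apply: Nt; right; rewrite E; [by left|by right].
    have Ft : upper_derivate F t 0.
      apply: contrapT => nF; apply: Nt; left; apply: N0P => /=.
      by move=> /(_ tab).
    apply: filterS (Ft e1 e10) => s [F1 F2].
    have z0 u v : trivIset setT (fun i : 'I_0 => `]u i, v i[%classic : set R).
      by move=> [].
    split=> [_ st|ts _]; exists 0%N, (fun=> 0), (fun=> 0); (split; [by case|exact: z0|by case|]);
      rewrite big_ord0 addr0; [move: (F1 st)|move: (F2 ts)]; by rewrite add0r.
have lenU := sum_length_le mU (fun i => (andP (pq i).1).2) tr pU.
have len : \sum_i (q i - p i) < d by rewrite -lte_fin; exact: le_lt_trans muU.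
have len1 : \sum_i (q i - p i) <= e1.
  by apply: ltW (lt_le_trans len _); rewrite ge_min lexx orbT.
have var : \sum_i `|Y (q i) - Y (p i)| < e1.
  by apply: acd => //; apply: (lt_le_trans len); rewrite ge_min lexx.
move: FP; rewrite -mulr_sumr big_split/=.
have : e1 * (b - a + 2 * C + 1) = e by rewrite /e1 mulfVK// gt_eqF.
set s1 := \sum_i (q i - p i) in len1 *; set s2 := \sum_i `|_| in var *.
have : C * (s1 + s2) <= C * (2 * e1) by rewrite ler_wpM2l//; lra.
lra.
Qed.

End AbsoluteContinuity.

(** * Integrating almost everywhere derivative bounds *)

Section Integration.
Context (R : realType).
Local Notation mu := (@lebesgue_measure R).

(** The integral of a nonnegative function is a supremum over simple functions below it, hence
    monotone without measurability. This serves integrands such as the norm of [g]. *)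
Lemma le_integral_nonmeasurable d (T : measurableType d)
    (nu : {measure set T -> \bar R}) (D : set T) (f1 f2 : T -> \bar R) :
  (forall x, D x -> (0 <= f1 x)%E) -> (forall x, D x -> (f1 x <= f2 x)%E) ->
  (\int[nu]_(x in D) f1 x <= \int[nu]_(x in D) f2 x)%E.
Proof.
move=> f10 f12.
have f20 x : D x -> (0 <= f2 x)%E by move=> Dx; apply: le_trans (f12 _ Dx); exact: f10.
rewrite !ge0_integralE//; apply: le_ereal_sup => _ [h hf1 <-]; exists h => // x.
by apply: (le_trans (hf1 x)); rewrite !patchE; case: ifPn => // /set_mem /f12.
Qed.

Lemma upper_derivate_is_derive (F : R -> R) (t l : R) : is_derive t 1 F l -> upper_derivate F t l.
Proof.
move=> /is_derive1_caratheodory [q [Fq qc <-]].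
apply: (@upper_derivate_quotient _ _ q).
  have qc1 : q @ t --> q t by exact: qc.
  exact: cvg_within_filter.
near=> s; rewrite Fq; split=> _ //.
by rewrite -opprB Fq -mulrN opprB.
Unshelve. all: by end_near. Qed.

(** [ac_nonincreasing] is applied to [F - G], where [G] is the indefinite integral of [h] and has
    derivative [h] almost everywhere. The lower bound on [h] keeps the increments of [F - G]
    dominated from above. *)
Lemma ac_le_integral (V : normedModType R) (Y : R -> V) (F h : R -> R) (a b C : R) :
  a <= b -> 0 <= C -> abs_continuous a b Y ->
  (forall u v, a <= u -> u <= v -> v <= b ->
     F v - F u <= C * ((v - u) + `|Y v - Y u|)) ->
  mu.-integrable `[a, b] (EFin \o h) ->
  (forall t, a <= t <= b -> - C <= h t) ->
  {ae mu, forall t, a < t < b -> upper_derivate F t (h t)} ->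
  F b - F a <= \int[mu]_(t in `[a, b]) h t.
Proof.
move=> ab C0 acY FC ih hC aeF.
(* Extended by zero, [h] is integrable on the whole line, so [FTC1] applies. *)
pose k := h \_ `[a, b].
have ik : mu.-integrable setT (EFin \o k).
  by rewrite -restrict_EFin; apply/integrable_restrict => //; rewrite setTI.
have kC t : - C <= k t.
  rewrite /k patchE; case: ifPn => [|_]; last by rewrite oppr_le0.
  by rewrite inE/= in_itv/= => /hC.
pose G t := \int[mu]_(s in `[a, t]) k s.
have GC u v : a <= u -> u <= v -> v <= b -> - C * (v - u) <= G v - G u.
  move=> au uv vb; rewrite /G Rintegral_itvB//; first last.
  - exact: integrableS ik.
  have -> : - C * (v - u) = \int[mu]_(s in `]u, v]) (- C).
    rewrite Rintegral_cst//; congr (_ * _).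
    rewrite [X in fine X](lebesgue_measure_itv `]u, v])/= lte_fin.
    by move: uv; rewrite le_eqVlt => /predU1P[->|->]; rewrite ?ltxx ?subrr.
  apply: le_Rintegral => //; last exact: integrableS ik.
  apply/integrableP; split; first exact: measurable_cst.
  rewrite integral_cst//= (lebesgue_measure_itv `]u, v])/=.
  by case: ifP => _; rewrite ?mule0 // -EFinB -EFinM ltry.
have aeG : {ae mu, forall t, a < t < b -> is_derive t 1 G (h t)}.
  have ik' y : mu.-integrable [set` Interval (BLeft a) (BRight y)] (EFin \o k).
    exact: integrableS ik.
  have lk : locally_integrable setT k by exact: integrable_locally.
  have := FTC1 ik' lk; apply: (@filterS _ (almost_everywhere mu)) => t Gt /andP[at_ tb].
  have [|dG Gk] := Gt; first by rewrite /= lte_fin.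
  have -> : h t = k t by rewrite /k patchE mem_set//= in_itv/= (ltW at_) ltW.
  by rewrite -Gk derive1E; exact: derivableP.
have Ga : G a = 0 by rewrite /G set_itv1 Rintegral_set1.
have Gb : G b = \int[mu]_(t in `[a, b]) h t.
  by apply: eq_Rintegral => t tab; rewrite /k patchE tab.
rewrite -Gb -[X in _ <= X]subr0 -Ga -subr_le0.
have -> : F b - F a - (G b - G a) = (F b - G b) - (F a - G a) by ring.
rewrite subr_le0.
apply: (@ac_nonincreasing _ _ Y (fun t => F t - G t) a b (C + C)) => //.
- exact: addr_ge0.
- move=> u v au uv vb; have := FC u v au uv vb; have := GC u v au uv vb.
  have : 0 <= C * `|Y v - Y u| by rewrite mulr_ge0.
  rewrite mulNr mulrDl [C * (_ + `|_|)]mulrDr.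
  by move: (C * (v - u)) (C * `|_|) (F v) (F u) (G v) (G u) => *; lra.
apply: (@filterS2 _ (almost_everywhere mu)) aeF aeG => t Ft Gt tab.
rewrite -(subrr (h t)); apply: upper_derivateD; first exact: Ft.
by apply: upper_derivate_is_derive; apply: is_deriveN; exact: Gt.
Qed.

(** Monotone convergence along the segments from [a] to [a + i%:R]. *)
Lemma integral_ray_ltoo (h : R -> R) (a C : R) :
  measurable_fun `[a, +oo[ h -> (forall t, a <= t -> 0 <= h t) ->
  (forall b, a <= b -> (\int[mu]_(t in `[a, b]) (h t)%:E <= C%:E)%E) ->
  (\int[mu]_(t in `[a, +oo[) (h t)%:E < +oo)%E.
Proof.
move=> mh h0 hC.
have E : `[a, +oo[%classic = \bigcup_i `[a, a + i%:R]%classic.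
  apply/seteqP; split=> [t|t [i _]]; rewrite /= !in_itv/= ?andbT; last by case/andP.
  move=> at_; exists (Num.truncn (t - a)).+1 => //=; rewrite in_itv/= at_/=.
  by rewrite -lerBlDl ltW// truncnS_gt.
have sub i : `[a, a + i%:R] `<=` `[a, +oo[.
  by move=> t; rewrite /= !in_itv/= => /andP[->].
apply: (@le_lt_trans _ _ C%:E); last exact: ltry.
rewrite E.
pose F (i : nat) : set R := `[a, a + i%:R]%classic.
have cv : (\int[mu]_(t in F i) (h t)%:E)%E @[i --> \oo] -->
    (\int[mu]_(t in \bigcup_i F i) (h t)%:E)%E.
  apply: ge0_nondecreasing_set_cvg_integral => //.
  - move=> i j ij; apply/subsetPset => t; rewrite /F/= !in_itv/= => /andP[->/= /le_trans].
    by apply; rewrite lerD2l ler_nat.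
  - by move=> i; exact: measurable_itv.
  - move=> i; apply/measurable_EFinP.
    by apply: (measurable_funS _ (sub i) mh); exact: measurable_itv.
  - by move=> i t; rewrite /F/= in_itv/= => /andP[/h0 + _]; rewrite lee_fin.
by apply: (cvge_le _ cv); apply: nearW => i; apply: hC; rewrite lerDl.
Qed.

End Integration.

(* [`|g|] itself need not be Borel measurable, only almost everywhere equal to
   a Borel function. *)
Lemma strongly_measurable_norm (R : realType) (V : normedModType R) (A : set R)
    (g : R -> V) : measurable A -> strongly_measurable A g ->
  exists gam : R -> R, [/\ measurable_fun setT gam,
    (forall t, 0 <= gam t <= `|g t|) &
    {ae lebesgue_measure, forall t, A t -> gam t = `|g t|}].
Proof.
move=> mA [s [sP [N [mN N0 NP]]]].
pose D := A `\` N.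
have mD : measurable D by exact: measurableD.
(* The value is 0 on the null set [N], which contains all points of [A] where the simple functions
   fail to converge to [g]. *)
exists ((fun t => `|g t|) \_ D); split.
- apply/(measurable_restrictT _ mD).
  apply: (@measurable_fun_cvg _ _ _ _ (fun n t => `|s n t|)) => [n|t [At nNt]].
    have [fin pre] := sP n.
    suff ms : measurable_fun A (fun t => `|s n t|) by apply: measurable_funS ms => // t [].
    move=> _ B mB.
    (* As [s n] takes finitely many values on [A], the preimage is a finite union of measurable
       level sets. *)
    have -> : A `&` (fun t => `|s n t|) @^-1` B =
        \bigcup_(y in (s n @` A) `&` [set y | B `|y|]) (A `&` s n @^-1` [set y]).
      apply/seteqP; split=> [t [At Bt]|t [y [_ By] [At sy]]]; last by split => //; rewrite /= sy.
      by exists (s n t) => //; split => //; exists t.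
    by apply: fin_bigcup_measurable => [|y _]; [exact: finite_setIl|exact: pre].
  have : s ^~ t @ \oo --> g t by apply: contrapT => h; apply: nNt; apply: NP => /= /(_ At).
  exact: cvg_norm.
- by move=> t; rewrite patchE; case: ifP => _; rewrite ?normr_ge0 ?lexx.
- exists N; split => // t /= h; apply: contrapT => nNt; apply: h => At.
  by rewrite patchE mem_set.
Qed.

(** * Derivatives along a domain *)

Section DeriveOn.
Context (R : realType) (V : normedModType R).

Lemma derive_on_quotient (A : set R) (f : R -> V) t : derivable_on A f t ->
  (s - t)^-1 *: (f s - f t) @[s --> within A t^'] --> derive_on A f t.
Proof.
move=> df.
have sh : (fun s => s - t) @ within A t^' --> within [set h | A (h + t)] (0 : R)^'.
  move=> B /nbhs_ballP[e /= e0 eB]; apply/nbhs_ballP; exists e => //= s st s_t As.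
  apply: eB; last by rewrite subrK.
    by move: st; rewrite /ball/= sub0r opprB.
  by rewrite subr_eq0.
have := cvg_comp _ _ sh df.
by apply: cvg_trans; apply: near_eq_cvg; apply: nearW => s /=; rewrite subrK.
Qed.

Lemma cvg_within_interior (T : topologicalType) (A : set R) (f : R -> T) (t : R) (l : T) :
  nbhs t A -> f s @[s --> within A t^'] --> l -> f s @[s --> t^'] --> l.
Proof.
move=> At; apply: cvg_trans => B /=; rewrite /within/= => AB.
by rewrite /nbhs/=; apply: filterS2 At AB => s As + st; apply.
Qed.

Lemma derive_on_near (A : set R) (f : R -> V) t e : A t -> derivable_on A f t ->
  0 < e -> \forall s \near t, A s ->
    `|f s - f t - (s - t) *: derive_on A f t| <= e * `|s - t|.
Proof.
move=> At /derive_on_quotient /cvgrPdist_lt fq e0.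
have := fq _ e0; rewrite /within/= => h; near=> s => As.
have [->|st] := eqVneq s t; first by rewrite !subrr scale0r subrr !normr0 mulr0.
have : `|derive_on A f t - (s - t)^-1 *: (f s - f t)| < e.
  by move: As; move: st; near: s.
move=> /ltW; rewrite -(ler_pM2r (_ : 0 < `|s - t|)) ?normr_gt0 ?subr_eq0//.
rewrite mulrC -normrZ scalerBr scalerA divff ?subr_eq0// scale1r distrC.
exact.
Unshelve. all: by end_near. Qed.

End DeriveOn.

(** * Integrals over segments and rays *)

Section Rays.
Context (R : realType).
Local Notation mu := (@lebesgue_measure R).

Lemma continuous_bounded_segment (V : normedModType R) (f : R -> V) (a b : R) :
  continuous f -> exists2 C, 0 <= C & forall t, a <= t <= b -> `|f t| <= C.
Proof.
move=> cf; have [ab|ba] := leP a b; last first.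
  exists 0 => // t /andP[at_ tb].
  by have := lt_le_trans ba (le_trans at_ tb); rewrite ltxx.
have [|c _ cP] := @EVT_max R (fun t => `|f t|) a b ab.
  by apply: continuous_subspaceT => t; exact: (cvg_norm (cf t)).
by exists `|f c| => // t tab; apply: cP; rewrite in_itv.
Qed.

Lemma continuous_integrable (p : R -> R) a b : continuous p ->
  mu.-integrable `[a, b] (EFin \o p).
Proof.
move=> cp; apply: continuous_compact_integrable; first exact: segment_compact.
exact: continuous_subspaceT.
Qed.

Lemma Rintegral_cst_segment (a b c : R) : a <= b ->
  \int[mu]_(t in `[a, b]) c = c * (b - a).
Proof.
move=> ab; rewrite Rintegral_cst//; congr (_ * _).
rewrite [X in fine X](lebesgue_measure_itv `[a, b])/= lte_fin.
by move: ab; rewrite le_eqVlt => /predU1P[->|->]; rewrite ?ltxx ?subrr.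
Qed.

Lemma Rintegral_segmentD (h : R -> R) (a b c : R) : a <= b -> b <= c ->
  mu.-integrable `[a, c] (EFin \o h) ->
  \int[mu]_(t in `[a, c]) h t = \int[mu]_(t in `[a, b]) h t + \int[mu]_(t in `[b, c]) h t.
Proof.
move=> ab bc ih.
rewrite -(Rintegral_itv_obnd_cbnd (r := b)); last first.
  by apply: integrableS ih => //; apply: subset_itvr; rewrite bnd_simp.
by rewrite -(Rintegral_itvB ih) ?bnd_simp//; ring.
Qed.

Lemma Rintegral_ray_le (h : R -> R) (t0 : R) : measurable_fun setT h ->
  (forall t, t0 <= t -> 0 <= h t) -> (\int[mu]_(t in `[t0, +oo[) (h t)%:E < +oo)%E ->
  exists2 C, 0 <= C & forall a b, t0 <= a ->
    mu.-integrable `[a, b] (EFin \o h) /\ \int[mu]_(t in `[a, b]) h t <= C.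
Proof.
move=> mh h0 hoo.
have ray0 t : `[t0, +oo[%classic t -> (0 <= (h t)%:E)%E.
  by rewrite /= in_itv/= andbT lee_fin => /h0.
have fin : (\int[mu]_(t in `[t0, +oo[) (h t)%:E)%E \is a fin_num.
  by rewrite ge0_fin_numE// integral_ge0.
exists (\int[mu]_(t in `[t0, +oo[) h t); first exact/fine_ge0/integral_ge0.
move=> a b ta.
have sub : `[a, b] `<=` `[t0, +oo[.
  by move=> t; rewrite /= !in_itv/= andbT => /andP[/(le_trans ta)].
have me (D : set R) : measurable_fun D (EFin \o h).
  by apply/measurable_EFinP; exact: measurable_funTS.
have le : (\int[mu]_(t in `[a, b]) (h t)%:E <= \int[mu]_(t in `[t0, +oo[) (h t)%:E)%E.
  apply: ge0_subset_integral => //; exact: me.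
have ih : mu.-integrable `[a, b] (EFin \o h).
  apply/integrableP; split; first exact: me.
  apply: le_lt_trans hoo; apply: le_trans le.
  rewrite le_eqVlt; apply/orP; left; apply/eqP; apply: eq_integral => t /set_mem /sub.
  by rewrite /= in_itv/= andbT => /h0 ?; rewrite ger0_norm.
split => //; rewrite /Rintegral fine_le//; exact: integrable_fin_num.
Qed.

Lemma Rintegral_ray_ltoo (h : R -> R) (t0 C : R) : continuous h ->
  (forall t, t0 <= t -> 0 <= h t) ->
  (forall b, t0 <= b -> \int[mu]_(t in `[t0, b]) h t <= C) ->
  (\int[mu]_(t in `[t0, +oo[) (h t)%:E < +oo)%E.
Proof.
move=> ch h0 hC; apply: (@integral_ray_ltoo _ _ _ C) => //.
  by apply: measurable_funTS; exact: continuous_measurable_fun.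
move=> b tb; rewrite -[leLHS]fineK ?lee_fin; first exact: hC.
by apply: integrable_fin_num => //; exact: continuous_integrable.
Qed.

(** Cauchy criterion: [T] is chosen so that the integral over [[t0, T]] is within [e] of the
    supremum of the integrals over [[t0, b]]. *)
Lemma Rintegral_tail (h : R -> R) (t0 C : R) :
  (forall a b, t0 <= a -> mu.-integrable `[a, b] (EFin \o h)) ->
  (forall t, t0 <= t -> 0 <= h t) ->
  (forall b, t0 <= b -> \int[mu]_(t in `[t0, b]) h t <= C) ->
  forall e, 0 < e -> exists2 T, t0 <= T &
    forall a b, T <= a -> a <= b -> \int[mu]_(t in `[a, b]) h t <= e.
Proof.
move=> ih h0 hC e e0.
pose S := [set I | exists2 b, t0 <= b & I = \int[mu]_(t in `[t0, b]) h t].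
have hS : has_sup S.
  split; first by exists (\int[mu]_(t in `[t0, t0]) h t), t0.
  by exists C => _ [b tb ->]; exact: hC.
have [_ [T tT ->] TS] := sup_adherent e0 hS.
exists T => // a b Ta ab.
have tb : t0 <= b by rewrite (le_trans tT)// (le_trans Ta).
have : \int[mu]_(t in `[t0, b]) h t <= sup S.
  by apply: sup_ubound; [case: hS|exists b].
rewrite (Rintegral_segmentD _ ab); [|exact: le_trans Ta|exact: ih].
rewrite (Rintegral_segmentD tT Ta); last exact: ih.
have : 0 <= \int[mu]_(t in `[T, a]) h t.
  by apply: Rintegral_ge0 => t; rewrite /= in_itv/= => /andP[/(le_trans tT)/h0].
lra.
Qed.

End Rays.

(** * Increments dominated by those of the velocity *)

Section Domination.
Context (R : realType) (V : normedModType R) (Y : R -> V) (t0 : R).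

(* Domination transfers absolute continuity from [Y] to [F]; the one-sided
   variant is all that is available for the terms involving [W]. *)
Definition dominated (W : normedModType R) (F : R -> W) (b : R) :=
  exists2 C, 0 <= C & forall u v, t0 <= u -> u <= v -> v <= b ->
    `|F v - F u| <= C * ((v - u) + `|Y v - Y u|).

Definition upper_dominated (F : R -> R) (b : R) :=
  exists2 C, 0 <= C & forall u v, t0 <= u -> u <= v -> v <= b ->
    F v - F u <= C * ((v - u) + `|Y v - Y u|).

Lemma upper_dominatedD F G b : upper_dominated F b -> upper_dominated G b ->
  upper_dominated (fun t => F t + G t) b.
Proof.
move=> [C C0 FC] [D D0 GD]; exists (C + D); first exact: addr_ge0.
move=> u v tu uv vb; have := FC u v tu uv vb; have := GD u v tu uv vb.
by rewrite mulrDl; lra.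
Qed.

Lemma dominatedD (W : normedModType R) (F G : R -> W) b : dominated F b -> dominated G b ->
  dominated (fun t => F t + G t) b.
Proof.
move=> [C C0 FC] [D D0 GD]; exists (C + D); first exact: addr_ge0.
move=> u v tu uv vb; rewrite opprD addrACA mulrDl.
by apply: le_trans (ler_normD _ _) _; rewrite lerD ?FC ?GD.
Qed.

Lemma dominatedZ (W : normedModType R) (F : R -> W) (a b : R) : dominated F b ->
  dominated (fun t => a *: F t) b.
Proof.
move=> [C C0 FC]; exists (`|a| * C); first exact: mulr_ge0.
move=> u v tu uv vb; rewrite -scalerBr normrZ -mulrA.
by rewrite ler_wpM2l// FC.
Qed.

Lemma dominated_idZ (W : normedModType R) (F : R -> W) (b : R) : continuous F ->
  dominated F b -> dominated (fun t => t *: F t) b.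
Proof.
move=> cF [C C0 FC]; have [B B0 FB] := continuous_bounded_segment t0 b cF.
exists (`|b| * C + `|t0| * C + B); first by rewrite !addr_ge0// mulr_ge0.
move=> u v tu uv vb.
have -> : v *: F v - u *: F u = v *: (F v - F u) + (v - u) *: F u.
  by rewrite scalerBr scalerBl addrA subrK.
apply: le_trans (ler_normD _ _) _; rewrite !normrZ mulrDl lerD//.
  have vB : `|v| <= `|b| + `|t0|.
    rewrite ler_norml; apply/andP; split.
      by have := ler_norm (- t0); rewrite normrN; have := normr_ge0 b; lra.
    by have := ler_norm b; have := normr_ge0 t0; lra.
  by rewrite -mulrDl -mulrA ler_pM// FC.
rewrite mulrC ler_pM//; first by rewrite FB// tu (le_trans uv).
by rewrite ger0_norm ?subr_ge0// lerDl.
Qed.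

(** Difference of two squares, with [F] bounded on the segment by continuity. *)
Lemma upper_dominated_sqr_norm (W : normedModType R) (F : R -> W) (b : R) : continuous F ->
  dominated F b -> upper_dominated (fun t => `|F t| ^+ 2) b.
Proof.
move=> cF [C C0 FC]; have [B B0 FB] := continuous_bounded_segment t0 b cF.
exists ((B + B) * C); first by rewrite mulr_ge0// addr_ge0.
move=> u v tu uv vb.
have Fu : `|F u| <= B by rewrite FB// tu (le_trans uv).
have Fv : `|F v| <= B by rewrite FB// vb (le_trans tu).
rewrite subr_sqr mulrC -mulrA.
apply: (@le_trans _ _ ((`|F v| + `|F u|) * `|F v - F u|)).
  by rewrite ler_wpM2l ?addr_ge0//; exact: lerB_dist.
by rewrite ler_pM ?addr_ge0// ?FC// lerD.
Qed.

End Domination.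

Lemma continuous_maxl (R : realType) (c : R) : continuous (fun s : R => Num.max s c).
Proof.
move=> s; apply: (@continuous_max _ _ (id : R -> R^o) (cst c)).
  exact: cvg_id.
exact: cvg_cst.
Qed.

(** * Increments of the position and of the smoothed gap *)

Section Energy.
Context (R : realType) (H : completeNormedModType R) (dot : {dot H for idfun}).
Hypothesis dot_norm : forall u : H, dot u u = `|u| ^+ 2.
Local Notation mu := (@lebesgue_measure R).

(** The increment of the squared norm is the inner product of [F s + F t] with [F s - F t]. *)
Lemma upper_derivate_sqr_norm (F : R -> H) (t : R) (l : H) : {for t, continuous F} ->
  (s - t)^-1 *: (F s - F t) @[s --> t^'] --> l ->
  upper_derivate (fun s => `|F s| ^+ 2) t (2 * dot (F t) l).
Proof.
move=> cF qF.
have c1 : F s + F t @[s --> t^'] --> F t + F t.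
  apply: cvgD; last exact: cvg_cst.
  have cF1 : F @ t --> F t by exact: cF.
  exact: cvg_within_filter.
have -> : 2 * dot (F t) l = dot (F t + F t) l by rewrite dotDl mulr_natl.
apply: (upper_derivate_quotient (cvg_dot dot_norm c1 qF)).
have key s : `|F s| ^+ 2 - `|F t| ^+ 2 =
    dot (F s + F t) ((s - t)^-1 *: (F s - F t)) * (s - t).
  have [->|st] := eqVneq s t; first by rewrite !subrr mulr0.
  rewrite dotZr mulrAC mulVf ?subr_eq0// mul1r.
  by rewrite !dotE !dot_norm (dotC dot (F t) (F s)); ring.
near=> s; split=> _; last by rewrite key.
by rewrite -opprB key -mulrN opprB.
Unshelve. all: by end_near. Qed.

(* [Y] is the velocity, [G] the smoothed gradient along [X], [gg] the
   perturbation, [gam] a Borel version of its norm, [W] the smoothed gap plus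
   [kappa * M], and [K = 2 * kappa].  All functions are defined on the whole
   line, frozen to the left of [t0]. *)
Context (X Y G gg : R -> H) (W M gam : R -> R) (z : H) (alpha t0 K : R).
Hypotheses (alpha_ge3 : 3 <= alpha) (t0_gt0 : 0 < t0) (K_ge0 : 0 <= K).
Hypotheses (cX : continuous X) (cY : continuous Y) (cG : continuous G)
  (cW : continuous W) (cM : continuous M).
Hypotheses (W_ge0 : forall t, t0 <= t -> 0 <= W t)
  (M_ge0 : forall t, t0 <= t -> 0 <= M t) (gam_ge0 : forall t, 0 <= gam t)
  (gam_meas : measurable_fun setT gam).
Hypothesis W_incr : forall s t, t0 <= t -> t <= s -> W s - W t <= dot (G s) (X s - X t).
Hypothesis G_ge : forall t, t0 <= t -> W t - K * M t <= dot (G t) (X t - z).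
Hypothesis X_near : forall t e, t0 <= t -> 0 < e ->
  \forall s \near t, t0 <= s -> `|X s - X t - (s - t) *: Y t| <= e * `|s - t|.
Hypothesis X_quot : forall t, t0 < t -> (s - t)^-1 *: (X s - X t) @[s --> t^'] --> Y t.
Hypothesis Y_ac : forall a b, t0 <= a -> abs_continuous a b Y.
Hypothesis ode : {ae mu, forall t, t0 < t ->
  (s - t)^-1 *: (Y s - Y t) @[s --> t^'] --> gg t - (alpha / t) *: Y t - G t /\
  `|gg t| = gam t}.
Hypothesis gam_int : (\int[mu]_(t in `[t0, +oo[) (t * gam t)%:E < +oo)%E.
Hypothesis M_int : (\int[mu]_(t in `[t0, +oo[) (t * M t)%:E < +oo)%E.

(** [X] is Lipschitz on the segment because its derivative [Y] is bounded there by [B]. Local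
    first-order expansions with error slope 1, whence [B + 1], are patched together by
    [interval_gauge_ind]. *)
Lemma X_dominated b : dominated Y t0 X b.
Proof.
have [B B0 YB] := continuous_bounded_segment t0 b cY.
have B10 : 0 <= B + 1 by rewrite addr_ge0.
exists (B + 1) => // u v tu uv vb.
suff : `|X v - X u| <= (B + 1) * (v - u).
  by move=> /le_trans; apply; rewrite ler_wpM2l// lerDl.
apply: (@interval_gauge_ind R (fun u v => `|X v - X u| <= (B + 1) * (v - u)) u v uv).
  move=> p q r _ _ _ _ pq qr.
  rewrite -(subrKA (X q)) -(subrKA q r) mulrDr.
  exact: le_trans (ler_normD _ _) (lerD qr pq).
move=> t /andP[ut tv]; have tt : t0 <= t by exact: le_trans ut.
have key s : `|X s - X t - (s - t) *: Y t| <= 1 * `|s - t| ->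
    `|X s - X t| <= (B + 1) * `|s - t|.
  move=> h; rewrite -(subrK ((s - t) *: Y t) (X s - X t)).
  apply: le_trans (ler_normD _ _) _; rewrite mulrDl addrC lerD// normrZ mulrC.
  by rewrite ler_wpM2r// YB// tt (le_trans tv).
apply: filterS (X_near tt ltr01) => s hs; split=> [us st|ts sv].
  rewrite distrC -[t - s]ger0_norm ?subr_ge0// [`|t - s|]distrC.
  by apply/key/hs; exact: le_trans us.
rewrite -[s - t]ger0_norm ?subr_ge0//.
by apply/key/hs; exact: le_trans ts.
Qed.

(** The derivative bound is split into a continuous part [p] of any sign and a nonnegative
    integrable part [r], so that it is bounded below as [ac_le_integral] demands. *)
Lemma energy_le (F p r : R -> R) a b : t0 <= a -> a <= b ->
  upper_dominated Y t0 F b -> continuous p -> (forall t, a <= t -> 0 <= r t) ->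
  mu.-integrable `[a, b] (EFin \o r) ->
  {ae mu, forall t, a < t < b -> upper_derivate F t (p t + r t)} ->
  F b - F a <= \int[mu]_(t in `[a, b]) p t + \int[mu]_(t in `[a, b]) r t.
Proof.
move=> ta ab [C C0 FC] cp r0 ir aeF.
have [B B0 pB] := continuous_bounded_segment a b cp.
have ip := continuous_integrable a b cp.
rewrite -RintegralD//; apply: (ac_le_integral (Y := Y) (C := C + B)) => //.
- exact: addr_ge0.
- exact: Y_ac.
- move=> u v au uv vb; apply: le_trans (FC u v (le_trans ta au) uv vb) _.
  by apply: ler_wpM2r; [rewrite addr_ge0 ?subr_ge0|rewrite lerDl].
- exact: (integrableD _ ip ir).
- move=> t /[dup] tab /andP[at_ _]; rewrite opprD.
  have := r0 _ at_; have := pB t tab; rewrite ler_norml => /andP[+ _].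
  lra.
Qed.

(** By [W_incr] and Cauchy-Schwarz, [W] increases by at most a bound of [G] times the increment of
    [X], which is dominated. *)
Lemma upper_dominated_W b : upper_dominated Y t0 (fun t => 2 * (t ^+ 2 * W t)) b.
Proof.
have [C C0 XC] := X_dominated b.
have [Bg Bg0 GB] := continuous_bounded_segment t0 b cG.
have [Bw Bw0 WB] := continuous_bounded_segment t0 b cW.
exists (2 * (b ^+ 2 * (Bg * C)) + 4 * `|b| * Bw).
  apply: addr_ge0; last by rewrite !mulr_ge0.
  by apply: mulr_ge0 => //; apply: mulr_ge0; [exact: sqr_ge0|exact: mulr_ge0].
move=> u v tu uv vb.
have u0 : 0 < u by exact: lt_le_trans tu.
have v0 : 0 < v by exact: lt_le_trans uv.
have b0 : 0 < b by exact: lt_le_trans vb.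
have ub : u <= b by exact: le_trans vb.
have Wvu : W v - W u <= Bg * C * ((v - u) + `|Y v - Y u|).
  apply: le_trans (W_incr tu uv) _; apply: le_trans (ler_dot dot_norm _ _) _.
  by rewrite -mulrA ler_pM// ?XC// GB// vb (le_trans tu).
have Wu : W u <= Bw by apply: le_trans (ler_norm _) _; rewrite WB// tu.
rewrite (gtr0_norm b0).
set d := v - u + _ in Wvu *.
have d1 : v - u <= d by rewrite lerDl.
have d0 : 0 <= d by rewrite addr_ge0// subr_ge0.
have -> : 2 * (v ^+ 2 * W v) - 2 * (u ^+ 2 * W u) =
  2 * (v ^+ 2 * (W v - W u)) + 2 * ((v + u) * ((v - u) * W u)) by ring.
have -> : (2 * (b ^+ 2 * (Bg * C)) + 4 * b * Bw) * d =
  2 * (b ^+ 2 * (Bg * C * d)) + 2 * ((b + b) * (d * Bw)) by ring.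
have W0 := W_ge0 tu.
apply: lerD; rewrite ler_pM2l//.
  apply: (@le_trans _ _ (v ^+ 2 * (Bg * C * d))).
    by rewrite ler_wpM2l// sqr_ge0.
  by rewrite ler_wpM2r ?mulr_ge0// ler_pXn2r// ?nnegrE ltW.
apply: ler_pM; [by rewrite addr_ge0// ltW|by rewrite mulr_ge0// subr_ge0| |].
  exact: lerD.
by apply: ler_pM => //; rewrite subr_ge0.
Qed.

(** The product rule, with [dot (G t) (Y t)] standing in for a derivative of [W]. *)
Lemma upper_derivate_W t : t0 < t -> upper_derivate (fun s => 2 * (s ^+ 2 * W s)) t
  (2 * (t ^+ 2 * dot (G t) (Y t) + 2 * (t * W t))).
Proof.
move=> tt.
have lim_dnbhs (V : normedModType R) (h : R -> V) : continuous h -> h @ t^' --> h t.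
  by move=> ch; have := ch t; exact: cvg_within_filter.
(* [W_incr] involves the gradient at the later of the two times, hence [Num.max s t]. *)
apply: (@upper_derivate_quotient _ _ (fun s => 2 * (s ^+ 2 *
    dot (G (Num.max s t)) ((s - t)^-1 *: (X s - X t)) + (s + t) * W t))).
  apply: cvgM; first exact: cvg_cst.
  apply: cvgD.
    apply: cvgM.
      by apply: (lim_dnbhs R (fun s : R => s ^+ 2)) => s; exact: (cvgM cvg_id cvg_id).
    apply: cvg_dot => //; last exact: X_quot.
    have := @lim_dnbhs _ (fun s => G (Num.max s t)); rewrite maxxx; apply=> s.
    by apply: continuous_comp; [exact: continuous_maxl|exact: cG].
  rewrite mulrA; apply: cvgM; last exact: cvg_cst.
  rewrite mulr_natl mulr2n; apply: cvgD; last exact: cvg_cst.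
  by apply: (lim_dnbhs R id) => s; exact: cvg_id.
have tn : \forall s \near t, t0 < s by exact: (cvgr_gt t cvg_id).
near=> s.
have ts : t0 <= s by apply: ltW; near: s; exact: tn.
have quot u : dot u (X s - X t) = dot u ((s - t)^-1 *: (X s - X t)) * (s - t).
  have [->|st] := eqVneq s t; first by rewrite !subrr mulr0 -(scale0r (0 : H)) dotZr mul0r.
  by rewrite dotZr mulrAC mulVf ?mul1r// subr_eq0.
split=> st.
- have := W_incr ts st; rewrite (max_r st) -(opprB (X s)) dotNr quot -mulrN opprB.
  set D := dot _ _ => Wts.
  have -> : 2 * (t ^+ 2 * W t) - 2 * (s ^+ 2 * W s) =
    2 * (s ^+ 2 * (W t - W s) + (t - s) * ((s + t) * W t)) by ring.
  have -> : 2 * (s ^+ 2 * D + (s + t) * W t) * (t - s) =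
    2 * (s ^+ 2 * (D * (t - s)) + (t - s) * ((s + t) * W t)) by ring.
  by rewrite ler_pM2l// lerD2r ler_wpM2l// sqr_ge0.
- have := W_incr (ltW tt) st; rewrite (max_l st) quot.
  set D := dot _ _ => Wts.
  have -> : 2 * (s ^+ 2 * W s) - 2 * (t ^+ 2 * W t) =
    2 * (s ^+ 2 * (W s - W t) + (s - t) * ((s + t) * W t)) by ring.
  have -> : 2 * (s ^+ 2 * D + (s + t) * W t) * (s - t) =
    2 * (s ^+ 2 * (D * (s - t)) + (s - t) * ((s + t) * W t)) by ring.
  by rewrite ler_pM2l// lerD2r ler_wpM2l// sqr_ge0.
Unshelve. all: by end_near. Qed.

Lemma quotient_idZ (F : R -> H) (t : R) (l : H) : {for t, continuous F} ->
  (s - t)^-1 *: (F s - F t) @[s --> t^'] --> l ->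
  (s - t)^-1 *: (s *: F s - t *: F t) @[s --> t^'] --> t *: l + F t.
Proof.
move=> cF qF.
have : s *: ((s - t)^-1 *: (F s - F t)) + F t @[s --> t^'] --> t *: l + F t.
  apply: cvgD; last exact: cvg_cst.
  apply: cvgZ => //; have ct : (fun s : R => s) @ t --> t by exact: cvg_id.
  exact: cvg_within_filter.
apply: cvg_trans; apply: near_eq_cvg; near=> s.
have st : s != t by near: s; exact: nbhs_dnbhs_neq.
have -> : s *: F s - t *: F t = s *: (F s - F t) + (s - t) *: F t.
  by rewrite scalerBr scalerBl addrA subrK.
by rewrite (scalerDr _ (s *: (F s - F t))) !scalerA mulVf ?subr_eq0// scale1r mulrC.
Unshelve. all: by end_near. Qed.

(** * Energy estimates for [alpha] at least 3 *)

Let v t := (alpha - 1) *: (X t - z) + t *: Y t.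
Let E t := 2 * (t ^+ 2 * W t) + `|v t| ^+ 2.
Let Z t := 2 * (t ^+ 2 * W t) + `|t *: Y t| ^+ 2.

Let cXz : continuous (fun t => X t - z).
Proof. by move=> t; apply: cvgB; [exact: cX|exact: cvg_cst]. Qed.

Let c_idZ (F : R -> H) : continuous F -> continuous (fun t : R => t *: F t).
Proof. by move=> cF t; apply: cvgZ; [exact: cvg_id|exact: cF]. Qed.

Let cv : continuous v.
Proof.
by move=> t; apply: cvgD; [apply: cvgZ; [exact: cvg_cst|exact: cXz]|exact: (c_idZ cY)].
Qed.

Let dXz b : dominated Y t0 (fun t => X t - z) b.
Proof.
have [C C0 XC] := X_dominated b; exists C => // p q tp pq qb.
by rewrite opprB addrA subrK XC.
Qed.

Let dY b : dominated Y t0 (fun t => t *: Y t) b.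
Proof.
apply: dominated_idZ => //; exists 1 => // p q tp pq qb.
by rewrite mul1r lerDr subr_ge0.
Qed.

Let dv b : dominated Y t0 v b.
Proof. by apply: dominatedD; [exact: dominatedZ|exact: dY]. Qed.

Let quot_Xz t : t0 < t -> (s - t)^-1 *: ((X s - z) - (X t - z)) @[s --> t^'] --> Y t.
Proof.
move=> tt; under eq_fun do rewrite opprB addrA subrK.
exact: X_quot.
Qed.

Lemma le_Rintegral_lincomb (f h : R -> R) (a b c d A B : R) : 0 <= c -> 0 <= d ->
  mu.-integrable `[a, b] (EFin \o f) -> mu.-integrable `[a, b] (EFin \o h) ->
  \int[mu]_(t in `[a, b]) f t <= A -> \int[mu]_(t in `[a, b]) h t <= B ->
  mu.-integrable `[a, b] (EFin \o (fun t => c * f t + d * h t)) /\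
  \int[mu]_(t in `[a, b]) (c * f t + d * h t) <= c * A + d * B.
Proof.
move=> c0 d0 fi hi fA hB.
have fc : mu.-integrable `[a, b] (EFin \o (fun t => c * f t)).
  exact: (integrableZl _ c fi).
have hd : mu.-integrable `[a, b] (EFin \o (fun t => d * h t)).
  exact: (integrableZl _ d hi).
split; first exact: (integrableD _ fc hd).
by rewrite RintegralD// !RintegralZl// lerD// ler_wpM2l.
Qed.

(** The perturbation terms of both energies are combinations of [t * gam t] and [t * M t];
    integrability on the ray bounds them uniformly over all segments. *)
Let r_integral : exists Ga Mc, [/\ 0 <= Ga, 0 <= Mc & forall c d a b,
  0 <= c -> 0 <= d -> t0 <= a ->
  mu.-integrable `[a, b] (EFin \o (fun t => c * (t * gam t) + d * (t * M t))) /\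
  \int[mu]_(t in `[a, b]) (c * (t * gam t) + d * (t * M t)) <= c * Ga + d * Mc].
Proof.
have t_ge0 t : t0 <= t -> 0 <= t by move=> tt; apply: le_trans tt; exact: ltW.
have mid : measurable_fun setT (fun t : R => t) by exact: measurable_id.
have [||Ga Ga0 GaP] := @Rintegral_ray_le R (fun t => t * gam t) t0 _ _ gam_int.
- exact: measurable_funM.
- by move=> t /t_ge0 ?; exact: mulr_ge0.
have [||Mc Mc0 McP] := @Rintegral_ray_le R (fun t => t * M t) t0 _ _ M_int.
- by apply: measurable_funM => //; exact: continuous_measurable_fun.
- by move=> t tt; apply: mulr_ge0; [exact: t_ge0|exact: M_ge0].
exists Ga, Mc; split => // c d a b c0 d0 ta.
have [? ?] := GaP a b ta; have [? ?] := McP a b ta.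
exact: le_Rintegral_lincomb.
Qed.

(** The weight [alpha - 1] in [v] is chosen so that all multiples of the velocity cancel:
    [alpha - 1] from the position, 1 from the product rule, [- alpha] from the damping. *)
Let v_quot t : t0 < t ->
  (s - t)^-1 *: (Y s - Y t) @[s --> t^'] --> gg t - (alpha / t) *: Y t - G t ->
  (s - t)^-1 *: (v s - v t) @[s --> t^'] --> t *: (gg t - G t).
Proof.
move=> tt qY.
have tn0 : t != 0 by rewrite gt_eqF// (lt_trans t0_gt0).
have -> : t *: (gg t - G t) = (alpha - 1) *: Y t +
    (t *: (gg t - (alpha / t) *: Y t - G t) + Y t).
  rewrite !scalerBr scalerA mulrCA divff// mulr1 scalerBl scale1r.
  by rewrite addrCA -!addrA (addrC (- Y t)) !addrA addrK addrAC subrK.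
have -> : (fun s => (s - t)^-1 *: (v s - v t)) = (fun s =>
    (alpha - 1) *: ((s - t)^-1 *: ((X s - z) - (X t - z))) +
    (s - t)^-1 *: (s *: Y s - t *: Y t)).
  apply/funext => s; rewrite /v opprD addrACA -scalerBr scalerDr; congr (_ + _).
  by rewrite !scalerA mulrC.
apply: cvgD; last exact: (quotient_idZ (@cY t) qY).
by apply: cvgZ; [exact: cvg_cst|exact: quot_Xz].
Qed.

Let c_tW : continuous (fun t : R => t * W t).
Proof. by move=> t; apply: cvgM; [exact: cvg_id|exact: cW]. Qed.

Let c_cM (c : R) (h : R -> R) : continuous h -> continuous (fun t : R => c * h t).
Proof. by move=> ch t; apply: cvgM; [exact: cvg_cst|exact: ch]. Qed.

Let c_tY2 : continuous (fun t : R => t * `|Y t| ^+ 2).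
Proof. by move=> t; apply: cvgM; [exact: cvg_id|apply: cvg_sqr_norm; exact: cY]. Qed.

(** The terms in [dot (G t) (Y t)] of the two summands of [E] cancel, and [G_ge] bounds what is left
    of the gradient. The coefficient of [t * W t] becomes [4 - 2 * (alpha - 1)]. *)
Lemma energy_increment_le a b S : t0 <= a -> a <= b -> 0 <= S ->
  (forall t, a <= t <= b -> `|v t| <= S) ->
  E b - E a <= \int[mu]_(t in `[a, b]) (- (2 * (alpha - 3)) * (t * W t)) +
    \int[mu]_(t in `[a, b]) (2 * S * (t * gam t) + 2 * (alpha - 1) * K * (t * M t)).
Proof.
move=> ta ab S0 vS.
have [Ga [Mc [Ga0 Mc0 rP]]] := r_integral.
have c1 : 0 <= 2 * S by rewrite mulr_ge0.
have a1 : 0 <= alpha - 1 by have := alpha_ge3; lra.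
have c2 : 0 <= 2 * (alpha - 1) * K by rewrite !mulr_ge0.
apply: energy_le => //.
- apply: upper_dominatedD; first exact: upper_dominated_W.
  by apply: upper_dominated_sqr_norm.
- by move=> t; apply: cvgM; [exact: cvg_cst|exact: c_tW].
- move=> t at_; have tt := le_trans ta at_; have t0' := le_trans (ltW t0_gt0) tt.
  apply: addr_ge0; apply: mulr_ge0 => //; apply: mulr_ge0 => //; exact: M_ge0.
- by have [] := rP _ _ a b c1 c2 ta.
apply: (@filterS _ (almost_everywhere mu)) ode => t ode_t /andP[at_ tb].
have tt : t0 < t by exact: le_lt_trans at_.
have [qY ggt] := ode_t tt.
have := upper_derivateD (upper_derivate_W tt) (upper_derivate_sqr_norm (@cv t) (v_quot tt qY)).
apply: le_upper_derivate.
have tp : 0 < t by exact: lt_trans tt.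
have h1 : t * dot (v t) (gg t) <= t * (S * gam t).
  rewrite ler_pM2l// -ggt; apply: le_trans (ler_dot dot_norm _ _) _.
  by rewrite ler_wpM2r// vS// (ltW at_) ltW.
have h2 : (t * (alpha - 1)) * (W t - K * M t) <= (t * (alpha - 1)) * dot (G t) (X t - z).
  by rewrite ler_wpM2l ?mulr_ge0// ?(ltW tp)// G_ge// ltW.
have -> : dot (v t) (t *: (gg t - G t)) = t * dot (v t) (gg t)
    - t * ((alpha - 1) * dot (G t) (X t - z) + t * dot (G t) (Y t)).
  rewrite dotZr dotDr dotNr mulrBr; congr (_ - t * _).
  by rewrite [v t]/v dotDl !dotZl (dotC dot (Y t)) (dotC dot (X t - z)).
set D := dot (G t) (X t - z) in h2 *; set B := dot (G t) (Y t).
move: (dot (v t) (gg t)) h1 => Q h1.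
rewrite -subr_ge0.
have -> : - (2 * (alpha - 3)) * (t * W t) + (2 * S * (t * gam t) +
      2 * (alpha - 1) * K * (t * M t)) -
   (2 * (t ^+ 2 * B + 2 * (t * W t)) + 2 * (t * Q - t * ((alpha - 1) * D + t * B))) =
   2 * (t * (S * gam t) - t * Q) + 2 * (t * (alpha - 1) * D - t * (alpha - 1) * (W t - K * M t)).
  by ring.
by rewrite addr_ge0// mulr_ge0// subr_ge0.
Qed.

Let W_int_ge0 a b : t0 <= a -> 0 <= \int[mu]_(t in `[a, b]) (t * W t).
Proof.
move=> ta; apply: Rintegral_ge0 => t; rewrite /= in_itv/= => /andP[at_ _].
have tt := le_trans ta at_.
by apply: mulr_ge0; [exact: le_trans (ltW t0_gt0) tt|exact: W_ge0].
Qed.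

Let E_bound_S a b S : t0 <= a -> a <= b -> 0 <= S -> (forall t, a <= t <= b -> `|v t| <= S) ->
  forall Ga Mc, (forall c d a b, 0 <= c -> 0 <= d -> t0 <= a ->
  mu.-integrable `[a, b] (EFin \o (fun t => c * (t * gam t) + d * (t * M t))) /\
  \int[mu]_(t in `[a, b]) (c * (t * gam t) + d * (t * M t)) <= c * Ga + d * Mc) ->
  E b + 2 * (alpha - 3) * \int[mu]_(t in `[a, b]) (t * W t) <=
    E a + 2 * S * Ga + 2 * (alpha - 1) * K * Mc.
Proof.
move=> ta ab S0 vS Ga Mc rP.
have := energy_increment_le ta ab S0 vS; rewrite RintegralZl//; last exact: continuous_integrable.
have c1 : 0 <= 2 * S by rewrite mulr_ge0.
have c2 : 0 <= 2 * (alpha - 1) * K.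
  by rewrite !mulr_ge0//; have := alpha_ge3; lra.
have [_ +] := rP _ _ a b c1 c2 ta.
set I := \int[mu]_(t in _) (_ + _); set J := \int[mu]_(t in _) _.
rewrite mulNr; set j := _ * J; lra.
Qed.

Let t2W_ge0 t : t0 <= t -> 0 <= 2 * (t ^+ 2 * W t).
Proof. by move=> /W_ge0 w0; rewrite mulr_ge0// mulr_ge0// sqr_ge0. Qed.

(** The energy estimate itself needs a bound on [v]. At a point [c] of [[t0, t]] where the norm of
    [v] has its maximum S, it reads S^2 <= [c0] + 2 S [Ga], which bounds S independently of [t]. *)
Lemma energy_v_bounded : exists2 S, 0 <= S & forall t, t0 <= t -> `|v t| <= S.
Proof.
have [Ga [Mc [Ga0 Mc0 rP]]] := r_integral.
pose c0 := E t0 + 2 * (alpha - 1) * K * Mc.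
have c00 : 0 <= c0.
  rewrite addr_ge0 ?mulr_ge0//; last by have := alpha_ge3; lra.
  by rewrite addr_ge0 ?t2W_ge0 ?sqr_ge0.
exists (2 * Ga + c0 + 1) => [|t tt]; first by move: c00 Ga0; lra.
have [|c tc cP] := @EVT_max R (fun s => `|v s|) t0 t tt.
  by apply: continuous_subspaceT => s; exact: (cvg_norm (@cv s)).
have vS s : t0 <= s <= t -> `|v s| <= `|v c| by move=> st; rewrite cP// in_itv.
apply: (@le_trans _ _ `|v c|); first by rewrite vS// tt lexx.
move: tc; rewrite in_itv/= => /andP[tc ct].
have := @E_bound_S t0 c `|v c| (lexx _) tc (normr_ge0 _) _ Ga Mc rP.
have vS' s : t0 <= s <= c -> `|v s| <= `|v c|.
  by move=> /andP[ts sc]; rewrite vS// ts (le_trans sc).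
move=> /(_ vS').
have W0 : 0 <= 2 * (alpha - 3) * \int[mu]_(t in `[t0, c]) (t * W t).
  by apply: mulr_ge0; [have := alpha_ge3; lra|exact: W_int_ge0].
have := t2W_ge0 tc.
rewrite [E c]/E; set q := 2 * (c ^+ 2 * W c); set S := `|v c|.
set I := _ * \int[mu]_(t in _) _ in W0 *.
move=> q0 h; have {h} : S ^+ 2 <= c0 + 2 * S * Ga by rewrite /c0; lra.
have S0 : 0 <= S by exact: normr_ge0.
(* Were [S] larger than [2 * Ga + c0 + 1], then [S * (S - 2 * Ga)] would be at least [c0 + 1], since
   also [S >= 1]. *)
move=> h; rewrite leNgt; apply/negP => lt.
have : (c0 + 1) * S <= (S - 2 * Ga) * S by rewrite ler_wpM2r//; lra.
have : c0 + 1 <= (c0 + 1) * S by rewrite ler_peMr//; lra.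
have -> : (S - 2 * Ga) * S = S ^+ 2 - 2 * S * Ga by ring.
by lra.
Qed.

Lemma energy_bounded : exists2 C, 0 <= C & forall b, t0 <= b ->
  E b + 2 * (alpha - 3) * \int[mu]_(t in `[t0, b]) (t * W t) <= C.
Proof.
have [S S0 vS] := energy_v_bounded; have [Ga [Mc [Ga0 Mc0 rP]]] := r_integral.
exists (E t0 + 2 * S * Ga + 2 * (alpha - 1) * K * Mc).
  rewrite !addr_ge0 ?t2W_ge0 ?sqr_ge0// !mulr_ge0//; have := alpha_ge3; lra.
move=> b tb; apply: E_bound_S => // t /andP[tt _]; exact: vS.
Qed.

Lemma energy_W_bounded : exists2 C, 0 <= C & forall t, t0 <= t -> t ^+ 2 * W t <= C.
Proof.
have [C C0 EC] := energy_bounded; exists C => // t tt.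
have := EC t tt.
have W0 : 0 <= 2 * (alpha - 3) * \int[mu]_(s in `[t0, t]) (s * W s).
  by apply: mulr_ge0; [have := alpha_ge3; lra|exact: W_int_ge0].
have := t2W_ge0 tt; have := sqr_ge0 `|v t|.
by rewrite /E; set I := _ * \int[mu]_(t in _) _ in W0 *; lra.
Qed.

(** * Boundedness, integrability and decay for [alpha] greater than 3 *)

Hypothesis alpha_gt3 : 3 < alpha.

Let W_int : exists2 C, 0 <= C & forall b, t0 <= b -> \int[mu]_(t in `[t0, b]) (t * W t) <= C.
Proof.
have [C C0 EC] := energy_bounded; exists (C / (2 * (alpha - 3))).
  by rewrite divr_ge0// mulr_ge0// subr_ge0 ltW.
move=> b tb; rewrite ler_pdivlMr ?mulr_gt0 ?subr_gt0// mulrC.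
apply: le_trans (EC b tb); rewrite lerDr.
by rewrite addr_ge0 ?t2W_ge0 ?sqr_ge0.
Qed.

Lemma energy_W_integrable : (\int[mu]_(t in `[t0, +oo[) (t * W t)%:E < +oo)%E.
Proof.
have [C C0 CP] := W_int; apply: (@Rintegral_ray_ltoo _ _ _ C) => // t tt.
by apply: mulr_ge0; [exact: le_trans (ltW t0_gt0) tt|exact: W_ge0].
Qed.

(** With p the norm of [X t - z], the derivative of the squared norm of [t *: (X t - z)] is 2 t
    ([dot (X t - z) (v t)] - ([alpha] - 2) p^2). As 2 p S <= p^2 + S^2 and [alpha] - 2 >= 1, this is
    at most t S^2. *)
Lemma energy_X_bounded : exists2 C, 0 <= C & forall t, t0 <= t -> `|X t - z| <= C.
Proof.
have [S S0 vS] := energy_v_bounded.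
exists (`|X t0 - z| + S) => [|b tb]; first by rewrite addr_ge0.
have b0 : 0 < b by exact: lt_le_trans tb.
have cp : continuous (fun t : R => t * S ^+ 2).
  by move=> t; apply: cvgM; [exact: cvg_id|exact: cvg_cst].
have : `|b *: (X b - z)| ^+ 2 - `|t0 *: (X t0 - z)| ^+ 2 <=
    \int[mu]_(t in `[t0, b]) (t * S ^+ 2) + \int[mu]_(t in `[t0, b]) 0.
  apply: (@energy_le (fun t => `|t *: (X t - z)| ^+ 2) _ (fun=> 0)) => //.
  - apply: upper_dominated_sqr_norm; first exact: c_idZ.
    by apply: dominated_idZ; [exact: cXz|exact: dXz].
  - by apply: continuous_integrable => t; exact: cvg_cst.
  apply: aeW => t /andP[tt _]; rewrite addr0.
  have tp : 0 < t by exact: lt_trans tt.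
  have := upper_derivate_sqr_norm (@c_idZ _ cXz t) (quotient_idZ (@cXz t) (quot_Xz tt)).
  apply: le_upper_derivate.
  have : t *: Y t = v t - (alpha - 1) *: (X t - z) by rewrite /v addrC addKr.
  move=> ->; move: (X t - z) (v t) (vS t (ltW tt)) => u w qS.
  rewrite dotZl dotDr dotDr dotNr dotZr dot_norm.
  have := ler_dot dot_norm u w; have := normr_ge0 u; have := normr_ge0 w.
  move: `|u| `|w| (dot u w) qS => p q D qS q0 p0 Dpq.
  have -> : 2 * (t * (D - (alpha - 1) * p ^+ 2 + p ^+ 2)) =
    t * (2 * (D - (alpha - 2) * p ^+ 2)) by ring.
  rewrite ler_pM2l//.
  have h1 : p ^+ 2 <= (alpha - 2) * p ^+ 2.
    by rewrite ler_peMl ?sqr_ge0//; have := alpha_ge3; lra.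
  have h2 : p * q <= p * S by rewrite ler_wpM2l.
  have : 0 <= (p - S) ^+ 2 by exact: sqr_ge0.
  rewrite sqrrB -mulr_natl; have := sqr_ge0 p.
  by move: h1 h2 Dpq; set x := p * q; set y := p * S; lra.
have -> : \int[mu]_(t in `[t0, b]) (0 : R) = 0 by rewrite Rintegral_cst_segment// mul0r.
rewrite addr0 !normrZ !exprMn (gtr0_norm b0) (gtr0_norm t0_gt0).
(* The crude bound [t <= b] suffices, because the result is divided by [b ^+ 2]. *)
have : \int[mu]_(t in `[t0, b]) (t * S ^+ 2) <= b * S ^+ 2 * b.
  apply: (@le_trans _ _ (\int[mu]_(t in `[t0, b]) (b * S ^+ 2))).
    apply: le_Rintegral => //; [exact: continuous_integrable| |].
      by apply: continuous_integrable => t; exact: cvg_cst.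
    by move=> t; rewrite /= in_itv/= => /andP[_ ?]; rewrite ler_wpM2r// sqr_ge0.
  rewrite Rintegral_cst_segment// ler_wpM2l//; first by rewrite mulr_ge0 ?sqr_ge0// ltW.
  by rewrite gerBl ltW.
move: (\int[mu]_(t in _) _) => I IS h.
have {h IS} h : b ^+ 2 * `|X b - z| ^+ 2 <= b ^+ 2 * (`|X t0 - z| + S) ^+ 2.
  apply: (@le_trans _ _ (b ^+ 2 * `|X t0 - z| ^+ 2 + b ^+ 2 * S ^+ 2)).
    have : t0 ^+ 2 * `|X t0 - z| ^+ 2 <= b ^+ 2 * `|X t0 - z| ^+ 2.
      by rewrite ler_wpM2r ?sqr_ge0// ler_pXn2r// nnegrE ltW.
    have -> : b ^+ 2 * S ^+ 2 = b * S ^+ 2 * b by ring.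
    by move: h IS; lra.
  rewrite -mulrDr ler_wpM2l ?sqr_ge0// sqrrD -addrA lerD2l lerDr.
  by rewrite mulrn_wge0// mulr_ge0.
move: h; rewrite ler_pM2l ?exprn_gt0// ler_pXn2r// ?nnegrE//.
by rewrite addr_ge0.
Qed.

Let tY_bounded : exists2 C, 0 <= C & forall t, t0 <= t -> `|t *: Y t| <= C.
Proof.
have [S S0 vS] := energy_v_bounded; have [C C0 XC] := energy_X_bounded.
have a1 : 0 <= alpha - 1 by have := alpha_ge3; lra.
exists (S + (alpha - 1) * C) => [|t tt]; first by rewrite addr_ge0// mulr_ge0.
have -> : t *: Y t = v t - (alpha - 1) *: (X t - z) by rewrite /v addrC addKr.
apply: le_trans (ler_normB _ _) _; rewrite normrZ (ger0_norm a1).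
by rewrite lerD ?vS// ler_wpM2l// XC.
Qed.

Let Z_integral a b :
  \int[mu]_(t in `[a, b]) (4 * (t * W t) + (- 4) * (t * `|Y t| ^+ 2)) =
  4 * \int[mu]_(t in `[a, b]) (t * W t) - 4 * \int[mu]_(t in `[a, b]) (t * `|Y t| ^+ 2).
Proof.
rewrite -mulNr -(RintegralZl 4)//; last exact: (continuous_integrable _ _ c_tW).
rewrite -(RintegralZl (- 4))//; last exact: (continuous_integrable _ _ c_tY2).
apply: RintegralD => //; first by apply: continuous_integrable; exact: c_cM.
by apply: continuous_integrable; exact: c_cM.
Qed.

(** The gradient terms cancel as for [E]. The velocity enters with coefficient [- 2 * (alpha - 1)],
    at most [- 4]; the zero multiple of [t * M t] gives the remainder the form used in
    [r_integral]. *)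
Lemma kinetic_increment_le a b S : t0 <= a -> a <= b -> 0 <= S ->
  (forall t, t0 <= t -> `|t *: Y t| <= S) ->
  Z b - Z a <= \int[mu]_(t in `[a, b]) (4 * (t * W t) + (- 4) * (t * `|Y t| ^+ 2)) +
    \int[mu]_(t in `[a, b]) (2 * S * (t * gam t) + 0 * (t * M t)).
Proof.
move=> ta ab S0 YS.
have [Ga [Mc [Ga0 Mc0 rP]]] := r_integral.
have c1 : 0 <= 2 * S by rewrite mulr_ge0.
apply: energy_le => //.
- apply: upper_dominatedD; first exact: upper_dominated_W.
  by apply: upper_dominated_sqr_norm; [exact: c_idZ|exact: dY].
- by move=> t; apply: cvgD; (apply: cvgM; first exact: cvg_cst); [exact: c_tW|exact: c_tY2].
- move=> t at_; have tt := le_trans ta at_; have t0' := le_trans (ltW t0_gt0) tt.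
  by rewrite mul0r addr0; apply: mulr_ge0 => //; exact: mulr_ge0.
- by have [] := rP _ _ a b c1 (lexx 0) ta.
apply: (@filterS _ (almost_everywhere mu)) ode => t ode_t /andP[at_ tb].
have tt : t0 < t by exact: le_lt_trans at_.
have [qY ggt] := ode_t tt.
have := upper_derivateD (upper_derivate_W tt)
  (upper_derivate_sqr_norm (@c_idZ _ cY t) (quotient_idZ (@cY t) qY)).
apply: le_upper_derivate.
have tp : 0 < t by exact: lt_trans tt.
have h1 : t * (t * dot (Y t) (gg t)) <= t * (S * gam t).
  rewrite ler_pM2l// -ggt -dotZl; apply: le_trans (ler_dot dot_norm _ _) _.
  by rewrite ler_wpM2r// YS// ltW.
rewrite dotZl dotDr dotZr !dotDr !dotNr dotZr dot_norm (dotC dot (Y t) (G t)).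
move: (dot (Y t) (gg t)) (dot (G t) (Y t)) (`|Y t| ^+ 2) (sqr_ge0 `|Y t|) h1 => Q B y2 y20 h1.
rewrite -subr_ge0.
have -> : 4 * (t * W t) + -4 * (t * y2) + (2 * S * (t * gam t) + 0 * (t * M t)) -
   (2 * (t ^+ 2 * B + 2 * (t * W t)) + 2 * (t * (t * (Q - alpha / t * y2 - B) + y2))) =
   2 * (t * (S * gam t) - t * (t * Q)) + 2 * ((alpha - 3) * (t * y2)).
  by field; rewrite gt_eqF.
rewrite addr_ge0// mulr_ge0// ?subr_ge0// mulr_ge0//; last by rewrite mulr_ge0// ltW.
by rewrite subr_ge0 ltW.
Qed.

Let Z_ge0 t : t0 <= t -> 0 <= Z t.
Proof. by move=> tt; rewrite addr_ge0 ?t2W_ge0 ?sqr_ge0. Qed.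

Let tY2_ge0 t : t0 <= t -> 0 <= t * `|Y t| ^+ 2.
Proof. by move=> tt; rewrite mulr_ge0 ?sqr_ge0// (le_trans _ tt)// ltW. Qed.

Let Y_int : exists2 C, 0 <= C & forall b, t0 <= b ->
  \int[mu]_(t in `[t0, b]) (t * `|Y t| ^+ 2) <= C.
Proof.
have [S S0 YS] := tY_bounded; have [C C0 CP] := W_int.
have [Ga [Mc [Ga0 Mc0 rP]]] := r_integral.
have c1 : 0 <= 2 * S by rewrite mulr_ge0.
exists (Z t0 + 4 * C + 2 * S * Ga) => [|b tb].
  by have := Z_ge0 (lexx t0); have := mulr_ge0 c1 Ga0; lra.
have := kinetic_increment_le (lexx t0) tb S0 YS.
rewrite Z_integral; have [_] := rP _ _ t0 b c1 (lexx 0) (lexx t0).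
have := CP b tb; have := Z_ge0 tb.
have J0 : 0 <= \int[mu]_(t in `[t0, b]) (t * `|Y t| ^+ 2).
  by apply: Rintegral_ge0 => t; rewrite /= in_itv/= => /andP[/tY2_ge0].
move: (\int[mu]_(t in _) (t * W t)) (\int[mu]_(t in _) (t * `|Y t| ^+ 2)) J0 => I J J0.
move: (\int[mu]_(t in _) (_ + _)) => r; rewrite mul0r addr0.
by move: (2 * S * Ga) => q; lra.
Qed.

Lemma energy_Y_integrable : (\int[mu]_(t in `[t0, +oo[) (t * `|Y t| ^+ 2)%:E < +oo)%E.
Proof.
by have [C C0 CP] := Y_int; apply: (@Rintegral_ray_ltoo _ _ _ C).
Qed.

(** Far out, [Z] takes a value at most [e] somewhere and can increase only little afterwards, so it
    stays below [2 * e]; [t ^+ 2 * W t] is at most half of [Z t]. *)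
Lemma energy_W_little_o e : 0 < e -> exists2 T, t0 <= T & forall t, T <= t -> t ^+ 2 * W t <= e.
Proof.
move=> e0.
have [S S0 YS] := tY_bounded; have [CW CW0 CWP] := W_int; have [CY CY0 CYP] := Y_int.
have [Ga [Mc [Ga0 Mc0 rP]]] := r_integral.
have c1 : 0 <= 2 * S by rewrite mulr_ge0.
have t_ge0 t : t0 <= t -> 0 <= t by move=> tt; apply: le_trans tt; exact: ltW.
have tW_ge0 t : t0 <= t -> 0 <= t * W t.
  by move=> tt; apply: mulr_ge0; [exact: t_ge0|exact: W_ge0].
pose r t := 2 * S * (t * gam t) + 0 * (t * M t).
have r_ge0 t : t0 <= t -> 0 <= r t.
  by move=> tt; rewrite /r mul0r addr0; apply: mulr_ge0 => //; apply: mulr_ge0 => //; exact: t_ge0.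
have ir a b : t0 <= a -> mu.-integrable `[a, b] (EFin \o r).
  by move=> ta; have [] := rP _ _ a b c1 (lexx 0) ta.
(* With tails of these sizes the integral of [Z t / t] over [[a0, 2 * a0]] is at most 3 e / 16, less
   than e / 2, and [Z] increases after [a0] by at most 4 e / 16 + e / 4. *)
have e4 : 0 < e / 4 by rewrite divr_gt0.
have e16 : 0 < e / 16 by rewrite divr_gt0.
have [T1 tT1 T1P] : exists2 T, t0 <= T &
    forall a b, T <= a -> a <= b -> \int[mu]_(t in `[a, b]) r t <= e / 4.
  apply: (@Rintegral_tail R r t0 (2 * S * Ga + 0 * Mc)) => // b tb.
  by have [] := rP _ _ t0 b c1 (lexx 0) (lexx t0).
have [T2 tT2 T2P] : exists2 T, t0 <= T &
    forall a b, T <= a -> a <= b -> \int[mu]_(t in `[a, b]) (t * W t) <= e / 16.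
  by apply: (@Rintegral_tail R _ t0 CW) => // a b _; exact: continuous_integrable.
have [T3 tT3 T3P] : exists2 T, t0 <= T &
    forall a b, T <= a -> a <= b -> \int[mu]_(t in `[a, b]) (t * `|Y t| ^+ 2) <= e / 16.
  by apply: (@Rintegral_tail R _ t0 CY) => // a b _; exact: continuous_integrable.
pose a0 := Num.max T1 (Num.max T2 T3).
have T1a : T1 <= a0 by rewrite le_max lexx.
have T2a : T2 <= a0 by rewrite !le_max lexx orbT.
have T3a : T3 <= a0 by rewrite !le_max lexx !orbT.
have ta0 : t0 <= a0 by exact: le_trans T1a.
have a00 : 0 < a0 by exact: lt_le_trans ta0.
have a0a : a0 <= 2 * a0 by lra.
(* Otherwise [Z t / t > e / (2 a0)] on [[a0, 2 a0]], against the smallness of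
   the integral of [Z t / t] there. *)
have [a /andP[a0a1 aa] Za] : exists2 a, a0 <= a <= 2 * a0 & Z a <= e.
  apply: contrapT => none.
  have Ze t : a0 <= t <= 2 * a0 -> e < Z t.
    by move=> at_; rewrite ltNge; apply/negP => Zt; apply: none; exists t.
  have cc : continuous (fun t : R => 2 * (t * W t) + t * `|Y t| ^+ 2).
    by move=> t; apply: cvgD; [apply: cvgM; [exact: cvg_cst|exact: c_tW]|exact: c_tY2].
  have : \int[mu]_(t in `[a0, 2 * a0]) (e / (2 * a0)) <=
      \int[mu]_(t in `[a0, 2 * a0]) (2 * (t * W t) + t * `|Y t| ^+ 2).
    apply: le_Rintegral => //; [|exact: continuous_integrable|].
      by apply: continuous_integrable => t; exact: cvg_cst.
    move=> t; rewrite /= in_itv/= => /[dup] at_ /andP[a0t ta].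
    have tp : 0 < t by exact: lt_le_trans a0t.
    have := Ze t at_; rewrite /Z normrZ exprMn (gtr0_norm tp) => Zt.
    have n0 : 0 <= 2 * (t * W t) + t * `|Y t| ^+ 2.
      by have tt := le_trans ta0 a0t; rewrite addr_ge0 ?tY2_ge0// mulr_ge0 ?tW_ge0.
    rewrite ler_pdivrMr ?mulr_gt0//; apply: ltW; apply: lt_le_trans Zt _.
    apply: (@le_trans _ _ ((2 * (t * W t) + t * `|Y t| ^+ 2) * t)); last by rewrite ler_wpM2l.
    by rewrite le_eqVlt; apply/orP; left; apply/eqP; ring.
  have i1 := continuous_integrable a0 (2 * a0) c_tW.
  have i2 := continuous_integrable a0 (2 * a0) c_tY2.
  rewrite Rintegral_cst_segment// RintegralD//; last by apply: continuous_integrable; exact: c_cM.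
  rewrite RintegralZl//.
  have -> : e / (2 * a0) * (2 * a0 - a0) = e / 2 by field; rewrite gt_eqF.
  have := T2P a0 (2 * a0) T2a a0a; have := T3P a0 (2 * a0) T3a a0a.
  lra.
have ta : t0 <= a by exact: le_trans a0a1.
have ca b : a <= b -> Z b <= 2 * e.
  move=> ab; have := kinetic_increment_le ta ab S0 YS.
rewrite Z_integral.
  have J0 : 0 <= \int[mu]_(t in `[a, b]) (t * `|Y t| ^+ 2).
    by apply: Rintegral_ge0 => t; rewrite /= in_itv/= => /andP[/(le_trans ta)/tY2_ge0].
  have := T1P a b (le_trans T1a a0a1) ab; have := T2P a b (le_trans T2a a0a1) ab.
  rewrite -/r; move: (\int[mu]_(t in _) r t) => q.
  move: (\int[mu]_(t in _) (t * W t)) (\int[mu]_(t in _) (t * `|Y t| ^+ 2)) J0 => I J J0.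
  by lra.
exists a => // b ab; have := ca b ab; rewrite /Z.
by have := sqr_ge0 `|b *: Y b|; lra.
Qed.

End Energy.

(** * From the trajectory to the energy estimates *)

Lemma derivable_on_continuous (R : realType) (V : normedModType R) (A : set R) (f : R -> V) t :
  A t -> derivable_on A f t -> f @ within A (nbhs t) --> f t.
Proof.
move=> At df; apply/cvgrPdist_le => e e0.
pose l := derive_on A f t.
have l1 : 0 < 1 + `|l| by rewrite ltr_pwDl.
have near1 := derive_on_near At df ltr01.
suff : \forall s \near t, A s -> `|f t - f s| <= e by [].
near=> s => As.
have h : `|f s - f t - (s - t) *: l| <= 1 * `|s - t| by move: As; near: s.
have st : `|s - t| <= e / (1 + `|l|).
  by rewrite distrC; near: s; apply/nbhs_ballP; exists (e / (1 + `|l|)) => /=;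
    [exact: divr_gt0|move=> u /ltW].
rewrite distrC -(subrK ((s - t) *: l) (f s - f t)).
apply: le_trans (ler_normD _ _) _; rewrite normrZ.
apply: (@le_trans _ _ ((1 + `|l|) * `|s - t|)); first by rewrite mulrDl lerD// mulrC.
by rewrite mulrC -ler_pdivlMr.
Unshelve. all: by end_near. Qed.

(** Freezing a function to the left of [t0] turns continuity along the ray into continuity on the
    whole line. *)
Lemma continuous_comp_maxl (R : realType) (T : topologicalType) (f : R -> T) (t0 : R) :
  {within `[t0, +oo[, continuous f} -> continuous (fun s : R => f (Num.max s t0)).
Proof.
move=> /subspace_continuousP cf s.
have At : `[t0, +oo[%classic (Num.max s t0) by rewrite /= in_itv/= le_max lexx orbT.
move=> B /(cf _ At); rewrite /within/= => AB.
have near_s : \forall u \near s, `[t0, +oo[%classic (Num.max u t0) -> B (f (Num.max u t0)).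
  exact: (@continuous_maxl R t0 s _ AB).
suff : \forall u \near s, B (f (Num.max u t0)) by [].
by apply: filterS near_s => u; apply; rewrite /= in_itv/= le_max lexx orbT.
Qed.

Lemma inf_range_argmin (R : realType) (T : Type) (f : T -> R) z : argmin f z ->
  inf (range f) = f z.
Proof.
move=> fz; apply/le_anti/andP; split.
  by apply: ge_inf; [exists (f z) => _ [y _ <-]; exact: fz|exists z].
by apply: lb_le_inf; [exists (f z), z|move=> _ [y _ <-]; exact: fz].
Qed.

Theorem theorem4p1 (R : realType) (H : completeNormedModType R)
    (dot : {dot H for idfun}) (dot_norm : forall u : H, dot u u = `|u| ^+ 2)
    (f : H -> R) (f_convex : convex_function setT f)
    (f_argmin : argmin f !=set0)
    (ft : H -> R -> R) (ft_smoothing : smoothing_function dot f ft)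
    (alpha t0 : R) (alpha_gt0 : 0 < alpha) (t0_gt0 : 0 < t0)
    (mu : R -> R)
    (mu_ge0 : forall t : R, 0 <= t -> 0 <= mu t)
    (mu_C1 : C1_on `[0, +oo[ (mu : R -> R^o))
    (mu_decr : forall s t : R, 0 <= s -> s < t -> mu t < mu s)
    (mu_lim : mu t @[t --> +oo] --> 0)
    (mu_int : (\int[lebesgue_measure]_(t in `[t0, +oo[) (t * mu t)%:E < +oo)%E)
    (g : R -> H) (g_meas : strongly_measurable `[t0, +oo[ g)
    (g_int : (\int[lebesgue_measure]_(t in `[t0, +oo[) (t * `|g t|)%:E < +oo)%E)
    (x : R -> H) (x_traj : trajectory dot ft mu g alpha t0 x) :
  (3 <= alpha ->
    (fun t => f (x t) - inf (range f) : R^o) =O_ (pinfty_nbhs R) (fun t => t ^- 2 : R^o)) /\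
  (3 < alpha ->
    [/\ [bounded x t | t in `[t0, +oo[],
        (\int[lebesgue_measure]_(t in `[t0, +oo[)
           (t * (f (x t) - inf (range f)))%:E < +oo)%E,
        (\int[lebesgue_measure]_(t in `[t0, +oo[)
           (t * `|derive_on `[t0, +oo[ x t| ^+ 2)%:E < +oo)%E &
        (fun t => f (x t) - inf (range f) : R^o) =o_ (pinfty_nbhs R) (fun t => t ^- 2 : R^o)]).
Proof.
have [z fz] := f_argmin; rewrite (inf_range_argmin fz).
have [k k0 kP] := smoothing_param_lipschitz ft_smoothing.
have approx := smoothing_approx ft_smoothing kP.
pose A : set R := `[t0, +oo[%classic; pose y := derive_on A x.
have AE t : A t <-> t0 <= t by rewrite /A/= in_itv/= andbT.
pose X s := x (Num.max s t0); pose Y s := y (Num.max s t0).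
pose M s := mu (Num.max s t0).
pose G s := gradient dot (ft^~ (M s)) (X s).
pose W s := ft (X s) (M s) + k * M s - f z.
have maxE s : t0 <= s -> Num.max s t0 = s by move=> ?; exact: max_l.
have t0_ge0 t : t0 <= t -> 0 <= t by apply: le_trans; exact: ltW.
have c_ge0 s : 0 <= Num.max s t0 by rewrite le_max (ltW t0_gt0) orbT.
have mu_gt0 t : 0 <= t -> 0 < mu t.
  move=> t_ge0; apply: (@le_lt_trans _ _ (mu (t + 1))); first by rewrite mu_ge0// addr_ge0.
  by rewrite mu_decr// ltrDl.
have M_gt0 s : 0 < M s by exact: mu_gt0.
have M_decr s t : t <= s -> M s <= M t.
  rewrite /M => ts; have : Num.max t t0 <= Num.max s t0 by rewrite ge_max !le_max ts lexx orbT.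
  by rewrite le_eqVlt => /predU1P[->//|tsl]; apply/ltW/mu_decr.
have [x_der y_cont] := trajectory_C1 x_traj.
have cX : continuous X.
  by apply: continuous_comp_maxl; apply/subspace_continuousP => t At;
    apply: derivable_on_continuous => //; exact: x_der.
have cY : continuous Y by exact: continuous_comp_maxl.
have cM : continuous M.
  apply: continuous_comp_maxl; apply/subspace_continuousP => t /AE tt.
  have t_ge0 : 0 <= t by exact: t0_ge0.
  have At0 : `[0, +oo[%classic t by rewrite /= in_itv/= t_ge0.
  have := derivable_on_continuous At0 (mu_C1.1 t At0).
  apply: cvg_trans; apply: cvg_app; apply: within_subset => u /AE tu.
  by rewrite /= in_itv/= andbT t0_ge0.
have cG : continuous G.
  by move=> t; apply: (cvg_smoothing_gradient ft_smoothing) => //; [exact: cX|exact: cM].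
have cW : continuous W.
  move=> t; apply: cvgB; last exact: cvg_cst.
  apply: cvgD; first by apply: (cvg_smoothing ft_smoothing) => //; [exact: cX|exact: cM].
  by apply: cvgM; [exact: cvg_cst|exact: cM].
(* The term [k * M s] in [W] compensates the smoothing error, so that [W] dominates the true gap and
   is nonnegative. *)
have fW s : f (X s) - f z <= W s.
  have := approx (X s) _ (M_gt0 s); rewrite ler_norml => /andP[+ _]; rewrite /W.
  by move: (k * M s) => q; lra.
have W_ge0 t : t0 <= t -> 0 <= W t.
  by move=> _; apply: le_trans (fW t); rewrite subr_ge0; exact: fz.
have convex_le m u w : 0 < m -> ft u m + dot (gradient dot (ft^~ m) u) (w - u) <= ft w m.
  move=> m0; apply: (convex_gradient_le dot_norm (F := ft^~ m)).
    exact: (smoothing_convex ft_smoothing m0).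
  by have [+ _] := smoothing_C1_space ft_smoothing m0; apply.
(* The gradient inequality is used at the parameter [M s]; replacing [M s] by [M t] at [X t] costs
   [k * (M t - M s)], exactly what the term [k * M] in [W] gives back. *)
have W_incr s t : t0 <= t -> t <= s -> W s - W t <= dot (G s) (X s - X t).
  move=> tt ts; have := convex_le _ (X s) (X t) (M_gt0 s).
  rewrite -/(G s) -(opprB (X s)) dotNr.
  have := kP (X t) (M t) (M s) (M_gt0 s) (M_decr _ _ ts).
  rewrite ler_norml mulrBr => /andP[+ _]; rewrite /W.
  by move: (k * M t) (k * M s) (dot _ _) => p q d; lra.
(* One [k * M t] comes from the definition of [W], the other from the smoothing error at [z]. *)
have G_ge t : t0 <= t -> W t - (2 * k) * M t <= dot (G t) (X t - z).
  move=> tt; have := convex_le _ (X t) z (M_gt0 t).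
  rewrite -/(G t) -(opprB (X t)) dotNr.
  have := approx z _ (M_gt0 t); rewrite ler_norml -mulrA => /andP[_ +]; rewrite /W.
  by move: (k * M t) (dot _ _) => p d; lra.
have X_near t e : t0 <= t -> 0 < e ->
    \forall s \near t, t0 <= s -> `|X s - X t - (s - t) *: Y t| <= e * `|s - t|.
  move=> tt e0; have At := (AE t).2 tt.
  have := derive_on_near At (x_der t At) e0; apply: filterS => s + ts.
  by move=> /(_ ((AE s).2 ts)); rewrite /X /Y !maxE.
have quot (h : R -> H) t : t0 < t -> derivable_on A h t ->
    (s - t)^-1 *: (h (Num.max s t0) - h (Num.max t t0)) @[s --> t^'] --> derive_on A h t.
  move=> tt dh; have tn : \forall s \near t, t0 < s by exact: (cvgr_gt t cvg_id).
  have := cvg_within_interior _ (derive_on_quotient dh).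
  have An : nbhs t A by apply: filterS tn => s /ltW/AE.
  move=> /(_ An); apply: cvg_trans; apply: near_eq_cvg.
  rewrite /dnbhs /prop_near1/= /within/=; rewrite /nbhs/=; apply: filterS tn => s ts _.
  by rewrite !maxE// ltW.
have X_quot t : t0 < t -> (s - t)^-1 *: (X s - X t) @[s --> t^'] --> Y t.
  move=> tt; have := quot x t tt (x_der t ((AE t).2 (ltW tt))).
  by rewrite (_ : derive_on A x t = Y t)// /Y (maxE _ (ltW tt)).
have Y_ac a b : t0 <= a -> abs_continuous a b Y.
  move=> ta e e0.
  have sub : `[a, b] `<=` A.
    by move=> t; rewrite /= in_itv/= => /andP[at_ _]; apply/AE; exact: le_trans at_.
  have [d d0 dP] := trajectory_loc_ac x_traj sub e0; exists d => // n u v uv tr len.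
  have := dP n u v uv tr len; congr (_ < e); apply: eq_bigr => i _.
  have [/andP[au uv'] _] := uv i; have tu := le_trans ta au.
  by rewrite /Y !maxE// (le_trans tu).
have mA : measurable A by exact: measurable_itv.
have [gam [gam_meas gamP gam_ae]] := strongly_measurable_norm mA g_meas.
have gam_ge0 t : 0 <= gam t by have /andP[] := gamP t.
have gam_int : (\int[lebesgue_measure]_(t in `[t0, +oo[) (t * gam t)%:E < +oo)%E.
  apply: le_lt_trans g_int; apply: le_integral_nonmeasurable => t /AE tt.
    by rewrite lee_fin mulr_ge0// t0_ge0.
  by rewrite lee_fin ler_wpM2l ?t0_ge0//; have /andP[] := gamP t.
have M_int : (\int[lebesgue_measure]_(t in `[t0, +oo[) (t * M t)%:E < +oo)%E.
  apply: le_lt_trans mu_int; apply: le_integral_nonmeasurable => t /AE tt.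
    by rewrite lee_fin; apply: mulr_ge0; [exact: t0_ge0|exact: ltW].
  by rewrite /M maxE.
(* For [t0 < t] the derivative along the ray is two-sided; the equation is solved for the
   acceleration and combined with the almost everywhere equality of [gam] and the norm of [g]. *)
have ode : {ae lebesgue_measure, forall t, t0 < t ->
    (s - t)^-1 *: (Y s - Y t) @[s --> t^'] --> g t - (alpha / t) *: Y t - G t /\ `|g t| = gam t}.
  have := trajectory_ode x_traj; move: gam_ae.
  apply: (@filterS2 _ (almost_everywhere lebesgue_measure)) => t gt odet tt.
  have [dy ode] := odet (ltW tt); split; last by rewrite gt//; apply/AE/ltW.
  have := quot y t tt dy.
  suff -> : g t - (alpha / t) *: Y t - G t = derive_on A y t by [].
  by rewrite -ode /Y /G /X /M maxE ?ltW// -/A -/y addrAC addrK addrK.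
have K0 : 0 <= 2 * k by rewrite mulr_ge0// ltW.
have M_ge0 t : t0 <= t -> 0 <= M t by move=> _; exact: ltW.
have f_ge0 t : 0 <= f (x t) - f z by rewrite subr_ge0; exact: fz.
have fxW t : t0 <= t -> f (x t) - f z <= W t by move=> tt; have := fW t; rewrite /X maxE.
split=> alpha3.
  have [C C0 CW] := energy_W_bounded dot_norm alpha3 t0_gt0 K0 cX cY cG cW cM W_ge0 M_ge0
    gam_ge0 gam_meas W_incr G_ge X_near X_quot Y_ac ode gam_int M_int.
  (* The Landau constant must be positive, whereas [C] may be 0. *)
  apply/eqO_exP; exists (C + 1); first by rewrite ltr_wpDl.
  have ray : \forall t \near +oo, t0 <= t by apply: nbhs_pinfty_ge; exact: num_real.
  apply: filterS ray => t tt.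
  have tp : 0 < t by exact: lt_le_trans tt.
  rewrite ger0_norm// ger0_norm ?invr_ge0 ?sqr_ge0// ler_pdivlMr ?exprn_gt0// mulrC.
  apply: (@le_trans _ _ (t ^+ 2 * W t)); first by rewrite ler_wpM2l ?sqr_ge0// fxW.
  by apply: le_trans (CW t tt) _; rewrite lerDl.
have alpha3' := ltW alpha3.
split.
- have [C C0 CX] := energy_X_bounded dot_norm alpha3' t0_gt0 K0 cX cY cG cW cM W_ge0 M_ge0
    gam_ge0 gam_meas W_incr G_ge X_near X_quot Y_ac ode gam_int M_int.
  exists (C + `|z|); split; first exact: num_real.
  move=> r Cr t /AE tt; apply: le_trans (ltW Cr).
  rewrite -[x t](subrK z); apply: le_trans (ler_normD _ _) _; rewrite lerD2r.
  by have := CX t tt; rewrite /X maxE.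
- have := energy_W_integrable dot_norm alpha3' t0_gt0 K0 cX cY cG cW cM W_ge0 M_ge0
    gam_ge0 gam_meas W_incr G_ge X_near X_quot Y_ac ode gam_int M_int alpha3.
  apply: le_lt_trans; apply: le_integral_nonmeasurable => t /AE tt.
    by rewrite lee_fin mulr_ge0// t0_ge0.
  by rewrite lee_fin ler_wpM2l ?t0_ge0// fxW.
- have := energy_Y_integrable dot_norm alpha3' t0_gt0 K0 cX cY cG cW cM W_ge0 M_ge0
    gam_ge0 gam_meas W_incr G_ge X_near X_quot Y_ac ode gam_int M_int alpha3.
  apply: le_lt_trans; apply: le_integral_nonmeasurable => t /AE tt.
    by rewrite lee_fin mulr_ge0 ?sqr_ge0// t0_ge0.
  by rewrite /Y maxE.
- apply/eqoP => e e0.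
  have [T tT TW] := energy_W_little_o dot_norm alpha3' t0_gt0 K0 cX cY cG cW cM W_ge0 M_ge0
    gam_ge0 gam_meas W_incr G_ge X_near X_quot Y_ac ode gam_int M_int alpha3 e0.
  have ray : \forall t \near +oo, T <= t by apply: nbhs_pinfty_ge; exact: num_real.
  apply: filterS ray => t Tt.
  have tt : t0 <= t by exact: le_trans Tt.
  have tp : 0 < t by exact: lt_le_trans tt.
  rewrite ger0_norm// ger0_norm ?invr_ge0 ?sqr_ge0// ler_pdivlMr ?exprn_gt0// mulrC.
  apply: (@le_trans _ _ (t ^+ 2 * W t)); first by rewrite ler_wpM2l ?sqr_ge0// fxW.
  exact: TW.
Qed.
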